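(* Let $M_2$ be the algebra of $2\times 2$ matrices over $K$ and let $sl_2$ be its Lie subalgebra of all traceless matrices. (i) The $GL$-ideal $T(M_2,sl_2)$ of all weak polynomial identities of the pair $(M_2,sl_2)$ is generated, as a $GL$-ideal, by the two polynomials $$[x_1^2,x_2]\quad\text{and}\quad S_4(x_1,x_2,x_3,x_4)=\sum_{\sigma}(-1)^{\sigma}x_{\sigma(1)}x_{\sigma(2)}x_{\sigma(3)}x_{\sigma(4)},$$ where $\sigma$ runs over all permutations of $\{1,2,3,4\}$ and $(-1)^\sigma$ is the sign of $\sigma$. (ii) (Razmyslov) The weak Lie identities of the pair $(M_2,sl_2)$ follow from $[x_1^2,x_2]$; that is, every weak identity of $(M_2,sl_2)$ is an $L(X)$-consequence of $[x_1^2,x_2]$.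
   Context: $K$ is a fixed field of characteristic $0$. $K\langle X\rangle$ is the free associative algebra over $K$ on $X=\{x_1,x_2,\ldots\}$, and $\mathrm{sp}(X)$ is the vector subspace of $K\langle X\rangle$ spanned by $X$. $[a,b]=ab-ba$. $L(X)\subset K\langle X\rangle$ is the free Lie algebra on $X$, canonically embedded into $K\langle X\rangle$ (the Lie subalgebra generated by $X$ under the commutator). Let $R$ be an associative algebra and $G$ a vector subspace of $R$ generating $R$ as an algebra. A polynomial $f(x_1,\ldots,x_n)\in K\langle X\rangle$ is a weak (polynomial) identity of the pair $(R,G)$ if $f(g_1,\ldots,g_n)=0$ for all $g_1,\ldots,g_n\in G$. The set $T(R,G)$ of all weak identities of $(R,G)$ is an ideal of $K\langle X\rangle$, closed under linear substitutions of the variables. Let $\Omega\subset K\langle X\rangle$ be a family of polynomials such that $\omega(g_1,\ldots,g_n)\in G$ for every $\omega(x_1,\ldots,x_n)\in\Omega$ and all $g_1,\ldots,g_n\in G$. A weak identity $f_2$ is an $\Omega$-consequence of a weak identity $f_1(x_1,\ldots,x_n)$ if $f_2$ belongs to the ideal of $K\langle X\rangle$ generated by all $f_1(\omega_1,\ldots,\omega_n)$ with $\omega_1,\ldots,\omega_n\in\Omega$. When $[G,G]\subseteq G$, i.e. $G$ is a Lie subalgebra of $R$ under the commutator, one may take $\Omega=L(X)$; weak identities considered with this rule for consequences are called weak Lie identities. For a subset $H=\{h_i(x_1,\ldots,x_{n_i})\mid i\in I\}$ of $K\langle X\rangle$, the $GL$-ideal generated by $H$ is the ideal of $K\langle X\rangle$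 generated by all $h_i(\omega_1,\ldots,\omega_{n_i})$ with $i\in I$ and $\omega_j\in\mathrm{sp}(X)$. *)

(* Defs.v *)
From mathcomp Require Export all_boot all_algebra all_fingroup.
From mathcomp Require Export monalg.

Set Implicit Arguments.
Unset Strict Implicit.
Unset Printing Implicit Defensive.

Import GRing.Theory.
Local Open Scope ring_scope.

(* K<X> (unital), as the monoid algebra of the free monoid on nat, with X indexed from 0: [var K i] is x_{i+1}. *)
Notation free_alg K := {malg K[{fmonom nat}]}.

Definition var (K : fieldType) (i : nat) : free_alg K := << fmu i >>.

(* [eval g f] is f(g 0, g 1, ...): the algebra morphism K<X> -> A sending x_{i+1} to g i.
   Taking A = K<X> gives substitution. *)
Definition eval (K : fieldType) (A : lalgType K) (g : nat -> A)
    (f : free_alg K) : A :=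
  mmap (in_alg A) (fun w : {fmonom nat} => \prod_(i <- w) g i) f.

Definition lie_bracket (A : pzRingType) (a b : A) : A := a * b - b * a.

Definition spX (K : fieldType) (f : free_alg K) : Prop :=
  exists (s : seq nat) (c : nat -> K), f = \sum_(i <- s) c i *: var K i.

Arguments spX : clear implicits.

Inductive lieX (K : fieldType) : free_alg K -> Prop :=
| lieX_var i : lieX (var K i)
| lieX_add a b : lieX a -> lieX b -> lieX (a + b)
| lieX_scale c a : lieX a -> lieX (c *: a)
| lieX_bracket a b : lieX a -> lieX b -> lieX (lie_bracket a b).

Arguments lieX : clear implicits.

(* Since the ring is unital, a two-sided ring ideal of a K-algebra is
   automatically a K-subspace. *)
Inductive gen_ideal (A : pzRingType) (S : A -> Prop) : A -> Prop :=
| gen_ideal_mem a : S a -> gen_ideal S a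
| gen_ideal0 : gen_ideal S 0
| gen_ideal_add a b : gen_ideal S a -> gen_ideal S b -> gen_ideal S (a + b)
| gen_ideal_mull r a : gen_ideal S a -> gen_ideal S (r * a)
| gen_ideal_mulr r a : gen_ideal S a -> gen_ideal S (a * r).

(* The ideal generated by all h(w_1, ..., w_n), h in H, w_j in Omega.  All
   variables are substituted at once; those not occurring in h are irrelevant
   as soon as Omega is nonempty. *)
Definition Omega_ideal (K : fieldType) (Omega H : free_alg K -> Prop) :
    free_alg K -> Prop :=
  gen_ideal (fun p => exists h w,
    [/\ H h, forall i : nat, Omega (w i) & p = eval w h]).

Definition GL_ideal (K : fieldType) (H : free_alg K -> Prop) :
    free_alg K -> Prop :=
  Omega_ideal (spX K) H.

Definition Omega_consequence (K : fieldType) (Omega : free_alg K -> Prop)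
    (f1 f2 : free_alg K) : Prop :=
  Omega_ideal Omega (fun h => h = f1) f2.

(* Membership in T(A, G). *)
Definition weak_identity (K : fieldType) (A : lalgType K) (G : {pred A})
    (f : free_alg K) : Prop :=
  forall g : nat -> A, (forall i, g i \in G) -> eval g f = 0.

Definition sl2 (K : fieldType) : {pred 'M[K]_2} := [pred a | \tr a == 0].

Arguments sl2 : clear implicits.

Definition comm_sq (K : fieldType) : free_alg K :=
  lie_bracket (var K 0 ^+ 2) (var K 1).

Definition standard_poly (K : fieldType) (n : nat) : free_alg K :=
  \sum_(s : 'S_n) (-1) ^+ s *: \prod_(i < n) var K (s i).

(* Main.v *)
Require Import Defs.
From HB Require Import structures.
From mathcomp Require Import finmap zify ring.
From Stdlib Require Ncring_tac.

Set Implicit Arguments.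
Unset Strict Implicit.
Unset Printing Implicit Defensive.

Import GRing.Theory.
Local Open Scope ring_scope.

(** Write u o v = uv + vu, let t_ij = x_i o x_j, and let I be the ideal generated by all
    [t_ij, x_k] and all S_4(x_i, x_j, x_k, x_l), for single letters x_i.  The two parts of the theorem
    come from the cycle of inclusions

      weak identities <= I <= GL-ideal <= L(X)-consequences of [x_1^2, x_2] <= weak identities.

    The second inclusion is the polarization of [x_1^2, x_2], and the last one holds because
    the square of a traceless 2x2 matrix is scalar and brackets are traceless.  For the third
    one, S_4(p,q,r,s) = [p,q] o [r,s] - [p,r] o [q,s] + [p,s] o [q,r]; if all u o v with u, v
    in a Lie subalgebra commute with that subalgebra, then [p,q] o y = - q o [p,y] and
    [a,[b,c]] = 2 (a o b) c - 2 (a o c) b, and the three terms cancel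
    ([alt4_certificate], [alt4_gen_ideal]).

    The first inclusion is the heart of the matter.  It follows Weyl's reduction of vector
    invariants.  The polarization operators, i.e. the derivations E_ab sending x_b to x_a and
    the other letters to 0, preserve both I and the space T of weak identities.

    Reduction to three letters.  The normally ordered Capelli determinant on the letters
    i > 2 > 1 > 0 alternates four positions of a word.  Modulo I, letters standing between
    these positions can be moved out at the price of factors t, so that such an alternation
    is a combination of alternations of products of t's and of adjacent letters, which in turn
    are obtained from S_4 by bracketing with letters: the Capelli operator maps everything
    into I ([capelli4_ideal]).  On the other hand, when E_ab f lies in I for all a < b, it acts
    modulo I on a multihomogeneous f as a scalar, a natural number which is positive as soon as
    x_i occurs in f ([capelli_highest]).  As E_ab with a < b lowers the sum of the indices of
    the letters, induction on that sum leaves only the elements of T in three letters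
    ([reduction_to_three_letters]).

    Three letters.  Modulo I every polynomial in x_0, x_1, x_2 is a linear combination of
    ordered monomials x_0^a x_1^b x_2^c t_01^d t_02^p t_12^q ([mon_span_homog]).  On
    x_0 = X^n h, x_1 = X s + X^(n^5) h, x_2 = X^(n^2) hs + X^(n^3) s + X^(n^4) h, with h and s
    anticommuting involutions, the term of lowest degree of an ordered monomial is invertible,
    and its degree determines the six exponents; so ordered monomials are linearly independent
    as functions on triples of traceless matrices ([vanishes_mon_sum]). *)

(** * Brackets, ideals and alternating sums *)

(** These instances make [ncring] below decide identities in noncommutative rings. *)
#[export] Instance pzRing_ops (R : pzRingType) :
  @Ncring.Ring_ops R 0 1 +%R *%R (fun x y => x - y) -%R eq := {}.

#[export] Instance pzRing_ring (R : pzRingType) :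
  @Ncring.Ring R 0 1 +%R *%R (fun x y => x - y) -%R eq (pzRing_ops R).
Proof.
split=> //; try exact: RelationClasses.eq_equivalence.
- by move=> ? ? -> ? ? ->.
- by move=> ? ? -> ? ? ->.
- by move=> ? ? -> ? ? ->.
- by move=> ? ? ->.
- exact: add0r.
- exact: addrC.
- exact: addrA.
- exact: mul1r.
- exact: mulr1.
- exact: mulrA.
- exact: mulrDl.
- by move=> x y z; exact: mulrDr.
- exact: subrr.
Qed.

Ltac ncring := Ncring_tac.non_commutative_ring.

Section Brackets.
Variable R : pzRingType.
Implicit Types a b p q r s u v w : R.

Definition anticomm (a b : R) := a * b + b * a.

Definition alt4 (p q r s : R) :=
  anticomm (lie_bracket p q) (lie_bracket r s)
  - anticomm (lie_bracket p r) (lie_bracket q s)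
  + anticomm (lie_bracket p s) (lie_bracket q r).

Definition acomm_lie (u v w : R) := lie_bracket (anticomm u v) w.

(** The bracket form of S_4 as an explicit combination of the elements
    [u o v, w], valid in every ring.  It is obtained by rewriting [p,q] o y as
    - [q o y, p] - q o [p,y] and [a,[b,c]] as 2 (a o b) c - 2 (a o c) b up to such elements. *)
Lemma alt4_certificate p q r s :
  alt4 p q r s =
  - acomm_lie q (lie_bracket r s) p + acomm_lie r (lie_bracket q s) p
  - acomm_lie s (lie_bracket q r) p
  + (acomm_lie p r q + acomm_lie p r q) * s - (acomm_lie p s q + acomm_lie p s q) * r
  + anticomm q (acomm_lie p r s - acomm_lie p s r)
  - (acomm_lie p q r + acomm_lie p q r) * s + (acomm_lie p s r + acomm_lie p s r) * q
  - anticomm r (acomm_lie p q s - acomm_lie p s q)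
  + (acomm_lie p q s + acomm_lie p q s) * r - (acomm_lie p r s + acomm_lie p r s) * q
  + anticomm s (acomm_lie p q r - acomm_lie p r q).
Proof.
rewrite /alt4 /acomm_lie /anticomm /lie_bracket; ncring.
Qed.

Lemma acomm_lie_bracketD u v w :
  acomm_lie u v w = lie_bracket ((u + v) ^+ 2) w - lie_bracket (u ^+ 2) w
                    - lie_bracket (v ^+ 2) w.
Proof. rewrite /acomm_lie /anticomm /lie_bracket !expr2; ncring. Qed.

End Brackets.

Section GenIdeal.
Variables (R : pzRingType) (S : R -> Prop).
Implicit Types a b : R.
Local Notation I := (gen_ideal S).

Lemma gen_idealN a : I a -> I (- a).
Proof. by rewrite -mulN1r; apply: gen_ideal_mull. Qed.

Lemma gen_idealB a b : I a -> I b -> I (a - b).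
Proof. by move=> Ia Ib; apply: gen_ideal_add => //; apply: gen_idealN. Qed.

Lemma gen_idealMn a n : I a -> I (a *+ n).
Proof. by move=> Ia; rewrite -mulr_natr; apply: gen_ideal_mulr. Qed.

Lemma gen_ideal_sum (T : Type) (r : seq T) (P : pred T) (F : T -> R) :
  (forall i, P i -> I (F i)) -> I (\sum_(i <- r | P i) F i).
Proof.
move=> IF; elim/big_rec: _ => [|i x Pi Ix]; first exact: gen_ideal0.
by apply: gen_ideal_add => //; exact: IF.
Qed.

Lemma gen_ideal_congr a b : I (a - b) -> I b -> I a.
Proof. by move=> Iab Ib; rewrite -(subrK b a); apply: gen_ideal_add. Qed.

Lemma gen_ideal_sub (S' : R -> Prop) a :
  (forall b, S b -> gen_ideal S' b) -> I a -> gen_ideal S' a.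
Proof.
move=> SS'; elim=> [b /SS' //| | b c _ Ib _ Ic | r b _ Ib | r b _ Ib].
- exact: gen_ideal0.
- exact: gen_ideal_add.
- exact: gen_ideal_mull.
- exact: gen_ideal_mulr.
Qed.

(** Closure of G under brackets is essential: the certificate uses
    [q o [r,s], p], where one argument is itself a bracket. *)
Lemma alt4_gen_ideal (G : R -> Prop) p q r s :
    (forall a b, G a -> G b -> G (lie_bracket a b)) ->
    (forall u v w, G u -> G v -> G w -> I (acomm_lie u v w)) ->
  G p -> G q -> G r -> G s -> I (alt4 p q r s).
Proof.
move=> Glie Gacomm Gp Gq Gr Gs; rewrite alt4_certificate.
rewrite ![anticomm _ (acomm_lie _ _ _ - _)]/anticomm.
by repeat first [ apply: Gacomm | apply: gen_idealB | apply: gen_ideal_add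
     | apply: gen_idealN | apply: gen_ideal_mulr; apply: Gacomm
     | apply: gen_ideal_mulr; apply: gen_idealB
     | apply: gen_ideal_mulr; apply: gen_ideal_add
     | apply: gen_ideal_mull; apply: gen_idealB
     | apply: Glie | done ].
Qed.

End GenIdeal.

Section AltSum.
Variables (T : eqType) (V : zmodType).
Implicit Types (H : T -> seq T -> V) (S : seq T).

(** The Laplace expansion pattern: the sum over the positions j of S of
    (-1)^j H(c_j, S without c_j).  Recursion on S avoids explicit positions and signs. *)
Fixpoint alt_sum H S : V :=
  if S is c :: S' then H c S' - alt_sum (fun d S'' => H d (c :: S'')) S' else 0.

Lemma eq_alt_sum_in H1 H2 S :
  {in S, forall c, forall S', H1 c S' = H2 c S'} -> alt_sum H1 S = alt_sum H2 S.
Proof.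
elim: S H1 H2 => //= c S IH H1 H2 eqH; congr (_ - _); first exact/eqH/mem_head.
by apply: IH => d dS S'; apply: eqH; rewrite inE dS orbT.
Qed.

Lemma eq_alt_sum H1 H2 S :
  (forall c S', H1 c S' = H2 c S') -> alt_sum H1 S = alt_sum H2 S.
Proof. by move=> eqH; apply: eq_alt_sum_in => c _; apply: eqH. Qed.

Lemma alt_sum0 S : alt_sum (fun _ _ => 0) S = 0.
Proof. by elim: S => //= c S ->; rewrite subr0. Qed.

Lemma alt_sumD H1 H2 S :
  alt_sum (fun c S' => H1 c S' + H2 c S') S = alt_sum H1 S + alt_sum H2 S.
Proof. by elim: S H1 H2 => [|c S IH] H1 H2 /=; rewrite ?addr0 // IH opprD addrACA. Qed.

Lemma alt_sumN H S : alt_sum (fun c S' => - H c S') S = - alt_sum H S.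
Proof. by elim: S H => [|c S IH] H /=; rewrite ?oppr0 // IH opprK opprB addrC. Qed.

Lemma alt_sumB H1 H2 S :
  alt_sum (fun c S' => H1 c S' - H2 c S') S = alt_sum H1 S - alt_sum H2 S.
Proof. by rewrite alt_sumD alt_sumN. Qed.

(** Removing two entries in either order gives opposite signs. *)
Lemma alt_sum_swap (H : T -> T -> seq T -> V) S :
  alt_sum (fun c => alt_sum (H c)) S = - alt_sum (fun c => alt_sum (H^~ c)) S.
Proof.
elim: S H => [|c S IH] H /=; first by rewrite oppr0.
rewrite !alt_sumB (IH (fun d e S' => H d e (c :: S'))) !opprB.
by rewrite addrA.
Qed.

End AltSum.

Lemma alt_sum_exchange (T : eqType) (V : zmodType)
    (H : T -> seq T -> T -> seq T -> V) S B :
  alt_sum (fun c S' => alt_sum (H c S') B) S =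
  alt_sum (fun b B' => alt_sum (fun c S' => H c S' b B') S) B.
Proof.
elim: S H => [|c S IH] H /=; first by rewrite alt_sum0.
by rewrite alt_sumB IH.
Qed.

Lemma alt_sum_raddf (T : eqType) (V W : zmodType) (f : V -> W)
    (H : T -> seq T -> V) S :
  {morph f : x y / x - y} -> f (alt_sum H S) = alt_sum (fun c S' => f (H c S')) S.
Proof.
move=> fB; elim: S H => [|c S IH] H /=; last by rewrite fB IH.
by have := fB 0 0; rewrite !subrr.
Qed.

Lemma gen_ideal_alt_sum (T : eqType) (R : pzRingType) (G : R -> Prop)
    (H : T -> seq T -> R) S :
  (forall c S', gen_ideal G (H c S')) -> gen_ideal G (alt_sum H S).
Proof.
elim: S H => [|c S IH] H IH0 /=; first exact: gen_ideal0.
by apply: gen_idealB => //; apply: IH => d S'.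
Qed.

(** * The alternating sum of products over a symmetric group *)

Section AltProd.
Variable R : pzRingType.

Definition alt_prod n (h : 'I_n -> R) : R := \sum_(s : 'S_n) (-1) ^+ s * \prod_(i < n) h (s i).

Lemma lift_perm_pair_bij n :
  bijective (fun js : 'I_n.+1 * 'S_n => lift_perm ord0 js.1 js.2).
Proof.
apply: inj_card_bij => [[j s] [k t] /= eq_st|].
  have jk : j = k by rewrite -(lift_perm_id ord0 j s) eq_st lift_perm_id.
  congr pair => //; apply/permP => i; apply: (@lift_inj _ j).
  by rewrite -(lift_perm_lift ord0) eq_st lift_perm_lift jk.
by rewrite card_prod !card_Sn card_ord factS.
Qed.

(** Expansion along the first factor: a permutation of n+1 points is the image j of the first
    point together with a permutation of n points, lifted around j. *)
Lemma alt_prodS n (h : 'I_n.+1 -> R) :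
  alt_prod h = \sum_(j < n.+1) (-1) ^+ j * (h j * alt_prod (fun i => h (lift j i))).
Proof.
rewrite /alt_prod (reindex _ (onW_bij _ (lift_perm_pair_bij n))) /=.
rewrite -(pair_big predT predT (fun j s => (-1) ^+ lift_perm ord0 j s *
  \prod_(i < n.+1) h (lift_perm ord0 j s i))) /=.
apply: eq_bigr => j _; rewrite !mulr_sumr; apply: eq_bigr => s _.
rewrite big_ord_recl lift_perm_id odd_lift_perm /= signr_addb signr_odd -!mulrA; congr (_ * _).
rewrite (eq_bigr (fun i => h (lift j (s i)))); last by move=> i _; rewrite lift_perm_lift.
by rewrite !mulrA; congr (_ * _); rewrite -signr_odd commr_sign.
Qed.

Lemma alt_prod0 (h : 'I_0 -> R) : alt_prod h = 1.
Proof.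
rewrite /alt_prod (bigD1 1%g) //= [X in _ + X]big1 => [|s].
  by rewrite odd_perm1 big_ord0 mulr1 addr0.
by case/eqP; apply/permP => -[].
Qed.

(** The standard polynomial S_4 in its bracket form. *)
Lemma alt_prod4 (w : nat -> R) : alt_prod (fun i : 'I_4 => w i) = alt4 (w 0) (w 1) (w 2) (w 3).
Proof.
do 4!rewrite ?alt_prodS ?big_ord_recl ?big_ord0.
rewrite !alt_prod0 /= /bump /=.
rewrite !(add0n, addn0) -[(1 + 1)%N]/2%N -[(1 + 2)%N]/3%N.
rewrite -![(-1) ^+ 2]signr_odd -![(-1) ^+ 3]signr_odd /= !(expr0, expr1).
rewrite /alt4 /anticomm /lie_bracket; ncring.
Qed.

End AltProd.

(** * Free algebras and polarization operators *)

(** The argument uses only the universal property of K<X>.  Stating it for an abstract algebra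
    keeps unification from unfolding the construction of the monoid algebra. *)
Record free_algebra (K : fieldType) := FreeAlgebra {
  carrier :> algType K;
  letter : nat -> carrier;
  lift_words : forall V : lmodType K, (seq nat -> V) -> {linear carrier -> V};
  lift_wordsE : forall (V : lmodType K) (phi : seq nat -> V) s,
    lift_words phi (\prod_(i <- s) letter i) = phi s;
  words_span : forall P : carrier -> Prop,
    P 0 -> (forall c f g, P f -> P g -> P (c *: f + g)) ->
    (forall s, P (\prod_(i <- s) letter i)) -> forall f, P f
}.

Arguments letter {K} _ _.
Arguments lift_words {K} _ {V} _.

Section FreeAlgebra.
Variables (K : fieldType) (A : free_algebra K).
Local Notation x := (letter A).

Definition word (s : seq nat) : A := \prod_(i <- s) x i.

Lemma word_cons i s : word (i :: s) = x i * word s.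
Proof. exact: big_cons. Qed.

Lemma word_nil : word [::] = 1.
Proof. exact: big_nil. Qed.

Lemma word1 i : word [:: i] = x i.
Proof. exact: big_seq1. Qed.

Lemma word_cat s t : word (s ++ t) = word s * word t.
Proof. exact: big_cat. Qed.

Lemma lift_word (V : lmodType K) (phi : seq nat -> V) s :
  lift_words A phi (word s) = phi s.
Proof. exact: lift_wordsE. Qed.

Lemma word_ind (P : A -> Prop) :
  P 0 -> (forall c f g, P f -> P g -> P (c *: f + g)) -> (forall s, P (word s)) ->
  forall f, P f.
Proof. exact: words_span. Qed.

Fixpoint polar_on_word (a b : nat) (s : seq nat) : A :=
  if s is i :: s' then x i * polar_on_word a b s' + (x a * word s') *+ (i == b)
  else 0.

(** The classical polarization operator: the derivation x_b |-> x_a, other letters |-> 0. *)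
Definition polar (a b : nat) : {linear A -> A} := lift_words A (polar_on_word a b).

Lemma polar_letterM a b i f : polar a b (x i * f) = x i * polar a b f + (x a * f) *+ (i == b).
Proof.
elim/word_ind: f => [|c f g IHf IHg|s].
- by rewrite !mulr0 linear0 mulr0 mul0rn addr0.
- rewrite !mulrDr -!scalerAr !linearP /= IHf IHg mulrDr -scalerAr mulrnDl scalerMnr.
  by rewrite scalerDr addrACA.
by rewrite -word_cons /polar !lift_word.
Qed.

Lemma polar1 a b : polar a b 1 = 0.
Proof. by rewrite -word_nil /polar lift_word. Qed.

Lemma polarM a b f g : polar a b (f * g) = polar a b f * g + f * polar a b g.
Proof.
elim/word_ind: f => [|c f1 f2 IH1 IH2|s].
- by rewrite !mul0r linear0 mul0r addr0.
- by rewrite mulrDl -scalerAl !linearP /= IH1 IH2 !mulrDl -!scalerAl scalerDr addrACA.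
elim: s => [|i s IH]; first by rewrite word_nil polar1 mul0r !mul1r add0r.
by rewrite word_cons -mulrA !polar_letterM IH mulrDr mulrDl mulrnAl !mulrA addrAC.
Qed.

Lemma polar_letter a b i : polar a b (x i) = x a *+ (i == b).
Proof. by rewrite -[x i]mulr1 polar_letterM polar1 mulr0 add0r mulr1. Qed.

End FreeAlgebra.

(** * Alternation in four slots modulo the relations between letters *)

Lemma gen_idealZ (K : fieldType) (A : algType K) (S : A -> Prop) (c : K) f :
  gen_ideal S f -> gen_ideal S (c *: f).
Proof. by rewrite -mulr_algl; apply: gen_ideal_mull. Qed.

Lemma alt_sum_size (T : eqType) (V : zmodType) (H : T -> seq T -> V) (S : seq T) :
  (forall c S', (size S').+1 = size S -> H c S' = 0) -> alt_sum H S = 0.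
Proof.
elim: S H => //= c S IH H H0; rewrite H0 // sub0r IH ?oppr0 // => d S' sS'.
by rewrite H0 //= sS'.
Qed.

Section LetterIdeal.
Variables (K : fieldType) (A : free_algebra K).
Hypothesis charK0 : [pchar K] =i pred0.
Local Notation x := (letter A).

(** The defining relations of the GL-ideal, restricted to letters: in this form they are
    visibly permuted by polarization operators. *)
Variant letter_relation : A -> Prop :=
| letter_acomm a b c : letter_relation (acomm_lie (x a) (x b) (x c))
| letter_alt4 a b c d : letter_relation (alt4 (x a) (x b) (x c) (x d)).

Local Notation I := (gen_ideal letter_relation).

Definition gram (a b : nat) : A := anticomm (x a) (x b).

Lemma gram_central a b f : I (gram a b * f - f * gram a b).
Proof.
elim/word_ind: f => [|c f g If Ig|s].
- by rewrite mulr0 mul0r subrr; exact: gen_ideal0.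
- rewrite mulrDr [(_ + g) * _]mulrDl opprD addrACA -scalerAr -scalerAl -scalerBr.
  by apply: gen_ideal_add => //; apply: gen_idealZ.
elim: s => [|c s IH]; first by rewrite word_nil mulr1 mul1r subrr; exact: gen_ideal0.
rewrite word_cons.
have -> : gram a b * (x c * word A s) - x c * word A s * gram a b =
   lie_bracket (gram a b) (x c) * word A s + x c * (gram a b * word A s - word A s * gram a b).
  rewrite /lie_bracket; ncring.
apply: gen_ideal_add; last exact: gen_ideal_mull.
by apply/gen_ideal_mulr/gen_ideal_mem; exact: letter_acomm.
Qed.

Implicit Types (F : seq nat -> A) (S : seq nat).

(** A family F of elements indexed by lists stands for a product with as many free slots as
    the length of the list, to be filled by its entries in all orders with signs.  [wedge] adds
    a slot on the left, and [contract y] a slot paired with the letter y into a factor t. *)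
Definition wedge F S : A := alt_sum (fun c S' => x c * F S') S.
Definition contract y F S : A := alt_sum (fun c S' => gram c y * F S') S.
Definition empty_family S : A := (S == [::])%:R.
Definition wedge_power m : seq nat -> A := iter m wedge empty_family.

Lemma alt_sum_mull (a : A) (H : nat -> seq nat -> A) S :
  a * alt_sum H S = alt_sum (fun c S' => a * H c S') S.
Proof. by apply: (alt_sum_raddf (f := fun z => a * z)) => u v; rewrite mulrBr. Qed.

Lemma alt_sum_mulr (a : A) (H : nat -> seq nat -> A) S :
  alt_sum H S * a = alt_sum (fun c S' => H c S' * a) S.
Proof. by apply: (alt_sum_raddf (f := fun z => z * a)) => u v; rewrite mulrBl. Qed.

(** A letter standing after a slot c is moved to its left through x_c x_y = t_cy - x_y x_c. *)
Lemma wedge_mulvar y F S :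
  wedge (fun S' => x y * F S') S = contract y F S - x y * wedge F S.
Proof.
rewrite /wedge /contract alt_sum_mull -alt_sumB; apply: eq_alt_sum => c S'.
by rewrite /gram /anticomm mulrDl !mulrA addrK.
Qed.

Lemma gen_ideal_wedge F S : (forall S', I (F S')) -> I (wedge F S).
Proof. by move=> IF; apply: gen_ideal_alt_sum => c S'; apply: gen_ideal_mull. Qed.

Lemma gen_ideal_contract y F S : (forall S', I (F S')) -> I (contract y F S).
Proof. by move=> IF; apply: gen_ideal_alt_sum => c S'; apply: gen_ideal_mull. Qed.

Lemma wedgeD F1 F2 S : wedge (fun S' => F1 S' + F2 S') S = wedge F1 S + wedge F2 S.
Proof. by rewrite /wedge -alt_sumD; apply: eq_alt_sum => c S'; rewrite mulrDr. Qed.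

Lemma wedgeB F1 F2 S : wedge (fun S' => F1 S' - F2 S') S = wedge F1 S - wedge F2 S.
Proof. by rewrite /wedge -alt_sumB; apply: eq_alt_sum => c S'; rewrite mulrBr. Qed.

Lemma wedgeZ (c : K) F S : wedge (fun S' => c *: F S') S = c *: wedge F S.
Proof.
rewrite /wedge [RHS](alt_sum_raddf (f := fun z : A => c *: z)).
  by apply: eq_alt_sum => d S'; rewrite scalerAr.
by move=> u v; rewrite scalerBr.
Qed.

Lemma contractD y F1 F2 S :
  contract y (fun S' => F1 S' + F2 S') S = contract y F1 S + contract y F2 S.
Proof. by rewrite /contract -alt_sumD; apply: eq_alt_sum => c S'; rewrite mulrDr. Qed.

Lemma contractB y F1 F2 S :
  contract y (fun S' => F1 S' - F2 S') S = contract y F1 S - contract y F2 S.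
Proof. by rewrite /contract -alt_sumB; apply: eq_alt_sum => c S'; rewrite mulrBr. Qed.

Lemma contractZ y (c : K) F S : contract y (fun S' => c *: F S') S = c *: contract y F S.
Proof.
rewrite /contract [RHS](alt_sum_raddf (f := fun z : A => c *: z)).
  by apply: eq_alt_sum => d S'; rewrite scalerAr.
by move=> u v; rewrite scalerBr.
Qed.

Lemma eq_wedge F1 F2 : F1 =1 F2 -> wedge F1 =1 wedge F2.
Proof. by move=> eqF S; apply: eq_alt_sum => c S'; rewrite eqF. Qed.

Lemma eq_contract y F1 F2 : F1 =1 F2 -> contract y F1 =1 contract y F2.
Proof. by move=> eqF S; apply: eq_alt_sum => c S'; rewrite eqF. Qed.

Lemma wedge_contract y F S : I (wedge (contract y F) S + contract y (wedge F) S).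
Proof.
have -> : wedge (contract y F) S =
    alt_sum (fun c => alt_sum (fun d S' => x c * (gram d y * F S'))) S.
  by apply: eq_alt_sum => c S'; rewrite alt_sum_mull.
have -> : contract y (wedge F) S =
    - alt_sum (fun c => alt_sum (fun d S' => gram d y * (x c * F S'))) S.
  rewrite -(alt_sum_swap (fun c d S' => gram c y * (x d * F S'))).
  by apply: eq_alt_sum => c S'; rewrite alt_sum_mull.
rewrite -alt_sumB; apply: gen_ideal_alt_sum => c S1.
rewrite -alt_sumB; apply: gen_ideal_alt_sum => d S2.
rewrite !mulrA -mulrBl -opprB mulNr.
by apply/gen_idealN/gen_ideal_mulr/gram_central.
Qed.

Lemma contract_mulvar y z F S : I (contract y (fun S' => x z * F S') S - x z * contract y F S).
Proof.
rewrite /contract alt_sum_mull -alt_sumB; apply: gen_ideal_alt_sum => c S'.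
by rewrite !mulrA -mulrBl; apply/gen_ideal_mulr/gram_central.
Qed.

(** Moving the letter y to the left through m+1 slots leaves m+1 contractions with y;
    by antisymmetry they all agree modulo I, whence the factor m+1. *)
Lemma wedge_iter_mulvar y m F S :
  I ((-1) ^+ m.+1 *: iter m.+1 wedge (fun S' => x y * F S') S
     + m.+1%:R *: contract y (iter m wedge F) S - x y * iter m.+1 wedge F S).
Proof.
elim: m S => [|m IH] S.
  rewrite /= wedge_mulvar expr1 scaleN1r scale1r opprB subrK subrr.
  exact: gen_ideal0.
have := gen_ideal_wedge S IH.
rewrite [wedge _ S](_ : _ = (-1) ^+ m.+1 *: iter m.+2 wedge (fun S' => x y * F S') S
   + m.+1%:R *: wedge (contract y (iter m wedge F)) S
   - (contract y (iter m.+1 wedge F) S - x y * iter m.+2 wedge F S)); last first.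
  by rewrite wedgeB wedgeD !wedgeZ [in RHS]iterS -wedge_mulvar.
move=> I1; have := gen_idealZ m.+1%:R (wedge_contract y (iter m wedge F) S).
rewrite scalerDr -iterS => I2; have := gen_idealB I2 I1.
congr I; rewrite -[m.+2%:R]natr1 scalerDl scale1r [(-1) ^+ m.+2]exprS mulN1r scaleNr.
ncring.
Qed.

Lemma wedge_power_size m S : size S != m -> wedge_power m S = 0.
Proof.
elim: m S => [|m IH] S sS.
  by rewrite /wedge_power /= /empty_family -size_eq0 (negbTE sS).
rewrite [LHS]alt_sum_size // => c S' sS'.
change (x c * wedge_power m S' = 0); rewrite IH ?mulr0 //.
by rewrite -sS' eqSS in sS.
Qed.

Lemma wedge_power4 a b c d : wedge_power 4 [:: a; b; c; d] = alt4 (x a) (x b) (x c) (x d).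
Proof.
rewrite /wedge_power /= /wedge /= /empty_family /= /alt4 /anticomm /lie_bracket.
ncring.
Qed.

Lemma wedge_power4_ideal S : I (wedge_power 4 S).
Proof.
case: (eqVneq (size S) 4) => [|sS]; last by rewrite wedge_power_size //; exact: gen_ideal0.
case: S => [|a [|b [|c [|d [|]]]]] // _; rewrite wedge_power4.
by apply: gen_ideal_mem; exact: letter_alt4.
Qed.

Definition contracts (Y : seq nat) F : seq nat -> A := foldr contract F Y.

Lemma contractsB Y F1 F2 S :
  contracts Y (fun S' => F1 S' - F2 S') S = contracts Y F1 S - contracts Y F2 S.
Proof.
by elim: Y S => //= y Y IH S; rewrite -contractB; apply: eq_contract.
Qed.

Lemma contractsD Y F1 F2 S :
  contracts Y (fun S' => F1 S' + F2 S') S = contracts Y F1 S + contracts Y F2 S.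
Proof.
by elim: Y S => //= y Y IH S; rewrite -contractD; apply: eq_contract.
Qed.

Lemma contractsZ Y (c : K) F S :
  contracts Y (fun S' => c *: F S') S = c *: contracts Y F S.
Proof. by elim: Y S => //= y Y IH S; rewrite -contractZ; apply: eq_contract. Qed.

Lemma gen_ideal_contracts Y F S : (forall S', I (F S')) -> I (contracts Y F S).
Proof. by move=> IF; elim: Y S => //= y Y IH S; apply: gen_ideal_contract. Qed.

Lemma contracts_mulvar Y z F S :
  I (contracts Y (fun S' => x z * F S') S - x z * contracts Y F S).
Proof.
elim: Y S => [|y Y IH] S /=; first by rewrite subrr; exact: gen_ideal0.
apply: gen_ideal_congr (contract_mulvar y z (contracts Y F) S).
rewrite opprB addrA subrK -contractB.
exact: gen_ideal_contract.
Qed.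

Lemma mulr_wedge (a : A) F S : wedge F S * a = wedge (fun S' => F S' * a) S.
Proof. by rewrite /wedge alt_sum_mulr; apply: eq_alt_sum => c S'; rewrite mulrA. Qed.

Lemma mulr_contracts Y (a : A) F S :
  contracts Y F S * a = contracts Y (fun S' => F S' * a) S.
Proof.
elim: Y S => //= y Y IH S.
rewrite /contract alt_sum_mulr; apply: eq_alt_sum => c S'; by rewrite -mulrA IH.
Qed.

Lemma eq_contracts Y F1 F2 : F1 =1 F2 -> contracts Y F1 =1 contracts Y F2.
Proof. by move=> eqF; elim: Y => //= y Y IH S; exact: eq_contract. Qed.

Lemma wedge_power_mulvar m y S :
  wedge_power m S * x y = iter m wedge (fun S' => x y * empty_family S') S.
Proof.
elim: m S => [|m IH] S.
  by rewrite /wedge_power /= /empty_family; case: eqP; rewrite ?mulr1 ?mulr0 ?mul1r ?mul0r.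
by rewrite [LHS]mulr_wedge; apply: eq_wedge.
Qed.

(** For Y empty this is S_4 in I.  To trade a slot for a contraction, multiply on the right by
    x_y and move x_y to the left end: both extreme terms are in I, hence so is (m+1) times the
    contracted one, and characteristic 0 lets one divide. *)
Lemma contracts_wedge_power_ideal Y m S : (size Y + m)%N = 4 -> I (contracts Y (wedge_power m) S).
Proof.
elim/last_ind: Y m S => [|Y y IH] m S; first by rewrite add0n => ->; exact: wedge_power4_ideal.
rewrite size_rcons addSnnS => sYm; rewrite /contracts -cats1 foldr_cat /= -/(contracts _ _).
have nzm : m.+1%:R != 0 :> K by rewrite ((pcharf0P K).1 charK0).
rewrite -[contracts _ _ _]scale1r -(mulVf nzm) -scalerA; apply: gen_idealZ.
rewrite -contractsZ.
have W := gen_ideal_contracts Y S (fun S' => wedge_iter_mulvar y m empty_family S').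
rewrite contractsB contractsD contractsZ in W.
have E : contracts Y (iter m.+1 wedge (fun S' => x y * empty_family S')) S =
    contracts Y (wedge_power m.+1) S * x y.
  by rewrite mulr_contracts; apply: eq_contracts => S'; rewrite wedge_power_mulvar.
apply: gen_ideal_congr W.
rewrite E.
rewrite [X in I (_ - X)]addrAC opprD addrCA subrr addr0 opprB.
apply: gen_idealB.
  apply: gen_ideal_congr (contracts_mulvar _ _ _ _) _.
  by apply: gen_ideal_mull; apply: (IH m.+1).
by apply/gen_idealZ/gen_ideal_mulr/IH.
Qed.

(** Modulo I, alternations with n slots of words with n marked positions; closed under adding
    letters and slots on the left, although only contractions of pure wedge powers generate. *)
Inductive slots n : (seq nat -> A) -> Prop :=
| slots_wedge_power Y m : (size Y + m)%N = n -> slots n (contracts Y (wedge_power m))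
| slots0 : slots n (fun => 0)
| slotsB F1 F2 : slots n F1 -> slots n F2 -> slots n (fun S => F1 S - F2 S)
| slots_mulvar y F : slots n F -> slots n (fun S => x y * F S)
| slots_congr F1 F2 : (forall S, I (F1 S - F2 S)) -> slots n F1 -> slots n F2.

Lemma eq_slots n F1 F2 : F1 =1 F2 -> slots n F1 -> slots n F2.
Proof. by move=> eqF; apply: slots_congr => S; rewrite eqF subrr; exact: gen_ideal0. Qed.

Lemma gen_ideal_slots4 F : slots 4 F -> forall S, I (F S).
Proof.
elim=> {F} [Y m sYm S||F1 F2 _ I1 _ I2 S|y F _ IF S|F1 F2 I12 _ I1 S].
- exact: contracts_wedge_power_ideal.
- by move=> S; exact: gen_ideal0.
- exact: gen_idealB.
- exact: gen_ideal_mull.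
- by apply: gen_ideal_congr (I1 S); rewrite -opprB; exact: gen_idealN.
Qed.

Lemma wedge0 S : wedge (fun=> 0) S = 0.
Proof. by rewrite -[RHS](alt_sum0 _ S); apply: eq_alt_sum => c S'; rewrite mulr0. Qed.

Lemma contract0 y S : contract y (fun=> 0) S = 0.
Proof. by rewrite -[RHS](alt_sum0 _ S); apply: eq_alt_sum => c S'; rewrite mulr0. Qed.

Lemma slots_contract n y F : slots n F -> slots n.+1 (contract y F).
Proof.
elim=> {F} [Y m <-||F1 F2 _ S1 _ S2|z F _ SF|F1 F2 I12 _ S1].
- exact: (@slots_wedge_power _ (y :: Y)).
- by apply: eq_slots (slots0 _) => S; rewrite contract0.
- by apply: eq_slots (slotsB S1 S2) => S; rewrite contractB.
- by apply: slots_congr (slots_mulvar z SF) => S; rewrite -opprB; exact/gen_idealN/contract_mulvar.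
- by apply: slots_congr S1 => S; rewrite -contractB; apply: gen_ideal_contract.
Qed.

(** This is where the letters between two slots are moved out of the way. *)
Lemma slots_wedge n F : slots n F -> slots n.+1 (wedge F).
Proof.
elim=> {F} [Y m <-||F1 F2 _ S1 _ S2|z F SF SwF|F1 F2 I12 _ S1].
- elim: Y => [|y Y IH] /=; first exact: (@slots_wedge_power _ [::] m.+1).
  apply: slots_congr (slotsB (slots0 _) (slots_contract y IH)) => S.
  by rewrite sub0r -opprD addrC; exact/gen_idealN/wedge_contract.
- by apply: eq_slots (slots0 _) => S; rewrite wedge0.
- by apply: eq_slots (slotsB S1 S2) => S; rewrite wedgeB.
- apply: eq_slots (slotsB (slots_contract z SF) (slots_mulvar z SwF)) => S.
  by rewrite wedge_mulvar.
- by apply: slots_congr S1 => S; rewrite -wedgeB; apply: gen_ideal_wedge.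
Qed.

End LetterIdeal.

(** * The Capelli operator *)

Section Capelli.
Variables (K : fieldType) (A : free_algebra K).
Hypothesis charK0 : [pchar K] =i pred0.
Local Notation x := (letter A).
Local Notation I := (gen_ideal (@letter_relation K A)).
Implicit Types (f g : A) (B S : seq nat).

Definition alt_delete c (F : seq nat -> A) B : A :=
  alt_sum (fun b B' => F B' *+ (b == c)) B.

(** The normally ordered determinant of the matrix of polarizations sending a letter of B to a
    letter of S: choose in the word distinct positions carrying the letters of B and refill
    them by the letters of S, with the sign of the resulting bijection from B to S. *)
Fixpoint capelli_word s B S : A :=
  if s is i :: s' then
    x i * capelli_word s' B S
    + wedge (fun S' => alt_delete i (fun B' => capelli_word s' B' S') B) S
  else ((B == [::]) && (S == [::]))%:R.

Definition capelli B S : {linear A -> A} := lift_words A (fun s => capelli_word s B S).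

Lemma capelli1 B S : capelli B S 1 = ((B == [::]) && (S == [::]))%:R.
Proof. by rewrite -[in LHS]word_nil /capelli lift_word. Qed.

Lemma alt_delete_cons c F b B :
  alt_delete c F (b :: B) = F B *+ (b == c) - alt_delete c (fun B' => F (b :: B')) B.
Proof. by []. Qed.

Lemma alt_deleteD c F1 F2 B :
  alt_delete c (fun B' => F1 B' + F2 B') B = alt_delete c F1 B + alt_delete c F2 B.
Proof. by rewrite /alt_delete -alt_sumD; apply: eq_alt_sum => b B'; rewrite mulrnDl. Qed.

Lemma alt_deleteB c F1 F2 B :
  alt_delete c (fun B' => F1 B' - F2 B') B = alt_delete c F1 B - alt_delete c F2 B.
Proof. by rewrite /alt_delete -alt_sumB; apply: eq_alt_sum => b B'; rewrite mulrnBl. Qed.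

Lemma alt_delete_raddf (h : A -> A) c F B :
  {morph h : u v / u - v} -> h (alt_delete c F B) = alt_delete c (fun B' => h (F B')) B.
Proof.
move=> hB; rewrite /alt_delete alt_sum_raddf //; apply: eq_alt_sum => b B'.
have h0 : h 0 = 0 by have := hB 0 0; rewrite !subrr.
by case: (b == c).
Qed.

Lemma eq_alt_delete c F1 F2 B : F1 =1 F2 -> alt_delete c F1 B = alt_delete c F2 B.
Proof. by move=> eqF; apply: eq_alt_sum => b B'; rewrite eqF. Qed.

Lemma alt_delete_alt_sum c (H : nat -> seq nat -> seq nat -> A) B S :
  alt_delete c (fun B' => alt_sum (fun d S' => H d S' B') S) B =
  alt_sum (fun d S' => alt_delete c (H d S') B) S.
Proof.
rewrite [RHS]alt_sum_exchange; apply: eq_alt_sum => b B'.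
by rewrite (alt_sum_raddf (f := fun z : A => z *+ _)) // => u v; rewrite mulrnBl.
Qed.

Lemma alt_delete_swap c d F B : alt_delete c (alt_delete d F) B = - alt_delete d (alt_delete c F) B.
Proof.
have E c' d' : alt_delete c' (alt_delete d' F) B =
    alt_sum (fun a => alt_sum (fun b B' => F B' *+ (b == d') *+ (a == c'))) B.
  apply: eq_alt_sum => a B'.
  by rewrite (alt_sum_raddf (f := fun z : A => z *+ _)) // => u v; rewrite mulrnBl.
rewrite !E alt_sum_swap; congr (- _); apply: eq_alt_sum => a B'.
by apply: eq_alt_sum => b B''; rewrite mulrnAC.
Qed.

Lemma wedge_alt_delete i F B S :
  wedge (fun S' => alt_delete i (fun B' => F B' S') B) S =
  alt_delete i (fun B' => wedge (F B') S) B.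
Proof.
rewrite /wedge alt_delete_alt_sum; apply: eq_alt_sum => c S'.
by rewrite alt_delete_raddf // => u v; rewrite mulrBr.
Qed.

Lemma capelli_letterM i f B S :
  capelli B S (x i * f) =
  x i * capelli B S f + wedge (fun S' => alt_delete i (fun B' => capelli B' S' f) B) S.
Proof.
have wdZ c g (a : K) : a *: wedge (fun S' => alt_delete c (fun B' => capelli B' S' g) B) S =
     wedge (fun S' => alt_delete c (fun B' => a *: capelli B' S' g) B) S.
  rewrite -wedgeZ; apply: eq_wedge => S'.
  by rewrite (alt_delete_raddf (h := fun z => a *: z)) // => u v; rewrite scalerBr.
elim/word_ind: f => [|c f g IHf IHg|s].
- rewrite !mulr0 !linear0 mulr0 add0r -[LHS](wedge0 A S); apply: eq_wedge => S'.
  by rewrite /alt_delete -[LHS](alt_sum0 _ B); apply: eq_alt_sum => b B'; rewrite linear0 mul0rn.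
- rewrite !mulrDr -!scalerAr !linearP /= IHf IHg mulrDr -scalerAr scalerDr.
  rewrite addrACA wdZ -wedgeD; congr (_ + _); apply: eq_wedge => S'.
  by rewrite -alt_deleteD; apply: eq_alt_delete => B'; rewrite linearP.
rewrite -word_cons /capelli !lift_word /=; congr (_ + _).
by apply: eq_wedge => S'; apply: eq_alt_delete => B'; rewrite lift_word.
Qed.

Lemma capelli_nil S f : capelli [::] S f = if S is [::] then f else 0.
Proof.
elim/word_ind: f => [|c f g IHf IHg|s].
- by rewrite linear0; case: S.
- by rewrite linearP /= IHf IHg; case: (S) => // *; rewrite scaler0 addr0.
elim: s S => [|i s IH] S; first by rewrite word_nil capelli1; case: S.
rewrite word_cons capelli_letterM IH [X in _ + X](_ : _ = 0) ?addr0.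
  by case: S => // _ _; rewrite mulr0.
by rewrite -[RHS](wedge0 A S).
Qed.

(** Expansion along the column b: normal ordering means that E_cb followed by the smaller
    determinant overcounts the terms in which the letter just created by E_cb is replaced
    again; the second summand takes them away. *)
Lemma capelli_peel b B S f :
  capelli (b :: B) S f =
  alt_sum (fun c S' => capelli B S' (polar A c b f)
                       - alt_delete c (fun B' => capelli (b :: B') S' f) B) S.
Proof.
elim/word_ind: f B S => [|a f g IHf IHg|s] B S.
- rewrite linear0 -[LHS](alt_sum0 _ S); apply: eq_alt_sum => c S'.
  rewrite !linear0 sub0r -[LHS]oppr0; congr (- _).
  by rewrite /alt_delete -[LHS](alt_sum0 _ B); apply: eq_alt_sum => d B'; rewrite linear0 mul0rn.
- rewrite linearP /= IHf IHg (alt_sum_raddf (f := fun z : A => a *: z)); last first.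
    by move=> u v; rewrite scalerBr.
  rewrite -alt_sumD; apply: eq_alt_sum => c S'.
  rewrite !linearP /= scalerBr (alt_delete_raddf (h := fun z => a *: z)); last first.
    by move=> u v; rewrite scalerBr.
  rewrite addrACA -opprD -alt_deleteD; congr (_ - _); apply: eq_alt_delete => B'.
  by rewrite linearP.
elim: s B S => [|i s IH] B S.
  rewrite word_nil capelli1 -[LHS](alt_sum0 _ S); apply: eq_alt_sum => c S'.
  rewrite polar1 linear0 sub0r -[LHS]oppr0; congr (- _).
  by rewrite /alt_delete -[LHS](alt_sum0 _ B); apply: eq_alt_sum => d B'; rewrite capelli1 mul0rn.
rewrite word_cons; move: (word A s) IH => f IH.
pose P c B' S' := capelli B' S' (polar A c b f).
pose Q B' S' := capelli (b :: B') S' f.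
pose F B' S' := capelli B' S' f.
have L B' S' : capelli (b :: B') S' (x i * f) =
    x i * Q B' S' + (wedge (F B') S' *+ (b == i)
                     - wedge (fun S'' => alt_delete i (Q^~ S'') B') S').
  rewrite capelli_letterM; congr (_ + _).
  have -> : wedge (F B') S' *+ (b == i) = wedge (fun S'' => F B' S'' *+ (b == i)) S'.
    by case: (b == i) => //; rewrite mulr0n -[LHS](wedge0 A S').
  by rewrite -wedgeB.
pose W2 c S' := wedge (fun S'' => alt_delete c (F^~ S'') B) S'.
pose W3 c S' :=
  wedge (fun S'' => alt_delete i (P c ^~ S'') B - alt_delete i (alt_delete c (Q^~ S'')) B) S'.
have T3 : wedge (fun S' => alt_delete i (Q^~ S') B) S = - alt_sum W3 S.
  rewrite /W3 /wedge -alt_sum_swap; apply: eq_alt_sum => c S'.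
  rewrite -alt_sum_mull; congr (_ * _).
  under eq_alt_delete => B' do rewrite /Q IH.
  by rewrite alt_delete_alt_sum; apply: eq_alt_sum => d S''; rewrite alt_deleteB.
have R c S' : capelli B S' (polar A c b (x i * f))
    - alt_delete c (fun B' => capelli (b :: B') S' (x i * f)) B =
    x i * (P c B S' - alt_delete c (Q^~ S') B) + (x c * F B S' *+ (b == i) + W3 c S').
  rewrite polar_letterM linearD raddfMn /= !capelli_letterM -/(W2 c S').
  under eq_alt_delete => B' do rewrite L.
  rewrite alt_deleteD alt_deleteB /W3 wedgeB.
  have -> : alt_delete c (fun B' => x i * Q B' S') B = x i * alt_delete c (Q^~ S') B.
    by rewrite [RHS]alt_delete_raddf // => u v; rewrite mulrBr.
  have -> : alt_delete c (fun B' => wedge (F B') S' *+ (b == i)) B = W2 c S' *+ (b == i).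
    rewrite /W2 wedge_alt_delete [RHS](alt_delete_raddf (h := fun z => z *+ _)) //.
    by move=> u v; rewrite mulrnBl.
  have -> : alt_delete c (fun B' => wedge (fun S'' => alt_delete i (Q^~ S'') B') S') B =
      - wedge (fun S'' => alt_delete i (alt_delete c (Q^~ S'')) B) S'.
    rewrite -wedge_alt_delete -[RHS]sub0r -[X in X - _](wedge0 A S') -wedgeB.
    by apply: eq_wedge => S''; rewrite alt_delete_swap sub0r.
  rewrite (eq_sym i b) mulrnDl mulrBr -/(P c B S') -/(F B S').
  rewrite -/(P c).
  case: (b == i); rewrite ?mulr1n ?mulr0n; ncring.
rewrite L T3 opprK (IH B S : Q B S = _) alt_sum_mull.
under [RHS]eq_alt_sum => c S' do rewrite R.
rewrite !alt_sumD; congr (_ + (_ + _)).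
rewrite /wedge; case: (b == i); rewrite ?mulr1n ?mulr0n //.
by rewrite -[LHS](alt_sum0 _ S); apply: eq_alt_sum.
Qed.

(** The diagonal terms left by the corrections in the column expansion. *)
Fixpoint sum_skip (G : seq nat -> A) L : A :=
  if L is c :: L' then G L' + sum_skip (fun L'' => G (c :: L'')) L' else 0.

Lemma alt_delete_notin c F B : c \notin B -> alt_delete c F B = 0.
Proof.
move=> cB; rewrite -[RHS](alt_sum0 A B); apply: eq_alt_sum_in => b bB B'.
by case: eqP bB cB => // -> ->.
Qed.

Lemma alt_sum_delete_diag (G : seq nat -> seq nat -> A) B : uniq B ->
  alt_sum (fun c S' => alt_delete c (G^~ S') B) B = sum_skip (fun L => G L L) B.
Proof.
elim: B G => //= b B IH G /andP[bB uB]; rewrite alt_delete_cons eqxx mulr1n.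
rewrite [alt_delete b _ B]alt_delete_notin // subr0; congr (_ + _).
rewrite -(IH (fun B' S' => G (b :: B') (b :: S'))) // -alt_sumN.
apply: eq_alt_sum_in => c cB S'.
rewrite alt_delete_cons; case: eqP => [bc|_]; first by rewrite -bc (negbTE bB) in cB.
by rewrite mulr0n sub0r opprK.
Qed.

Lemma slotsD n F1 F2 : slots n F1 -> slots n F2 -> slots n (fun S => F1 S + F2 S : A).
Proof.
move=> S1 S2; apply: eq_slots (slotsB S1 (slotsB (slots0 A n) S2)) => S.
by rewrite sub0r opprK.
Qed.

Lemma slots_alt_delete n i (G : seq nat -> seq nat -> A) B :
  (forall B', (size B').+1 = size B -> slots n (G B')) ->
  slots n (fun S => alt_delete i (G^~ S) B).
Proof.
elim: B G => [|b B IH] G slG; first exact: (slots0 A n).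
apply: (@slotsB K A n (fun S => G B S *+ (b == i))).
  case: (b == i); last exact: (slots0 A n).
  by apply: eq_slots (slG B _) => // S.
by apply: (IH (fun B' => G (b :: B'))) => B' sB'; apply: slG; rewrite /= sB'.
Qed.

Lemma slots_capelli_word s B : slots (size B) (capelli_word s B).
Proof.
elim: s B => [|i s IH] B /=.
  case: B => [|b B]; first by apply: (@slots_wedge_power K A _ [::] 0).
  exact: (slots0 A _).
apply: slotsD; first exact: slots_mulvar.
case: B => [|b B].
  by apply: eq_slots (slots0 A _) => S; rewrite -[LHS](wedge0 A S).
apply: slots_wedge; apply: slots_alt_delete => B' [eqB]; rewrite -[X in slots X _]eqB; exact: IH.
Qed.

(** Capelli operators on four letters alternate four positions of each word. *)
Lemma capelli4_ideal B S f : size B = 4 -> I (capelli B S f).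
Proof.
move=> sB; elim/word_ind: f => [|c f g If Ig|s].
- by rewrite linear0; exact: gen_ideal0.
- by rewrite linearP; apply: gen_ideal_add => //; exact: gen_idealZ.
rewrite /capelli lift_word; have := slots_capelli_word s B; rewrite sB => sl.
exact: (gen_ideal_slots4 charK0 sl).
Qed.

Lemma polar_lie a b f g :
  polar A a b (lie_bracket f g) = lie_bracket (polar A a b f) g + lie_bracket f (polar A a b g).
Proof.
rewrite /lie_bracket linearB /= !polarM; ncring.
Qed.

Lemma polar_anticomm a b f g :
  polar A a b (anticomm f g) = anticomm (polar A a b f) g + anticomm f (polar A a b g).
Proof.
rewrite /anticomm linearD /= !polarM; ncring.
Qed.

Lemma polar_acomm_lie a b f g h :
  polar A a b (acomm_lie f g h) =
  acomm_lie (polar A a b f) g h + acomm_lie f (polar A a b g) h + acomm_lie f g (polar A a b h).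
Proof.
rewrite /acomm_lie polar_lie polar_anticomm /anticomm /lie_bracket.
ncring.
Qed.

Lemma polar_alt4 a b p q r s :
  polar A a b (alt4 p q r s) =
  alt4 (polar A a b p) q r s + alt4 p (polar A a b q) r s
  + alt4 p q (polar A a b r) s + alt4 p q r (polar A a b s).
Proof.
rewrite /alt4 linearD linearB /= !polar_anticomm !polar_lie /anticomm /lie_bracket.
ncring.
Qed.

Lemma gen_ideal_polar a b f : I f -> I (polar A a b f).
Proof.
elim=> {f} [_ [i j k|i j k l]||f g _ If _ Ig|r f If' IDf|r f If' IDf].
- rewrite polar_acomm_lie !polar_letter.
  have Z u v : acomm_lie 0 u v = 0 :> A.
    by rewrite /acomm_lie /anticomm /lie_bracket mul0r mulr0 addr0 mul0r mulr0 subr0.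
  have Z' u v : acomm_lie u 0 v = 0 :> A.
    by rewrite /acomm_lie /anticomm /lie_bracket mul0r mulr0 addr0 mul0r mulr0 subr0.
  have Z'' u v : acomm_lie u v 0 = 0 :> A.
    by rewrite /acomm_lie /anticomm /lie_bracket mul0r mulr0 subr0.
  have IA u v w : I (acomm_lie (x u) (x v) (x w)).
    by apply: gen_ideal_mem; exact: letter_acomm.
  have I0 := gen_ideal0 (@letter_relation K A).
  by apply: gen_ideal_add; [apply: gen_ideal_add|]; case: eqP => _;
     rewrite ?mulr1n ?mulr0n ?Z ?Z' ?Z''.
- rewrite polar_alt4 !polar_letter.
  have Z u v w : alt4 0 u v w = 0 :> A.
    by rewrite /alt4 /anticomm /lie_bracket; ncring.
  have Z1 u v w : alt4 u 0 v w = 0 :> A.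
    by rewrite /alt4 /anticomm /lie_bracket; ncring.
  have Z2 u v w : alt4 u v 0 w = 0 :> A.
    by rewrite /alt4 /anticomm /lie_bracket; ncring.
  have Z3 u v w : alt4 u v w 0 = 0 :> A.
    by rewrite /alt4 /anticomm /lie_bracket; ncring.
  have IA u v w t : I (alt4 (x u) (x v) (x w) (x t)).
    by apply: gen_ideal_mem; exact: letter_alt4.
  have I0 := gen_ideal0 (@letter_relation K A).
  by apply: gen_ideal_add; [apply: gen_ideal_add; [apply: gen_ideal_add|]|]; case: eqP => _;
     rewrite ?mulr1n ?mulr0n ?Z ?Z1 ?Z2 ?Z3.
- by rewrite linear0; exact: gen_ideal0.
- by rewrite linearD; exact: gen_ideal_add.
- by rewrite polarM; apply: gen_ideal_add; exact: gen_ideal_mull.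
- by rewrite polarM; apply: gen_ideal_add; exact: gen_ideal_mulr.
Qed.

Lemma gen_ideal_alt_sum_in (H : nat -> seq nat -> A) S :
  {in S, forall c, forall S', I (H c S')} -> I (alt_sum H S).
Proof.
elim: S H => [|c S IH] H IH0 /=; first exact: gen_ideal0.
apply: gen_idealB; first exact/IH0/mem_head.
by apply: IH => d dS S'; apply: IH0; rewrite inE dS orbT.
Qed.

Lemma gen_ideal_alt_delete c G B :
  (forall B', (size B' < size B)%N -> I (G B')) -> I (alt_delete c G B).
Proof.
elim: B G => [|d B IH] G IG; first exact: gen_ideal0.
apply: gen_idealB; first by apply: gen_idealMn; apply: IG.
by apply: (IH (fun B' => G (d :: B'))) => B' sB'; apply: IG.
Qed.

(** Capelli operators are polynomials in polarizations, by the column expansion. *)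
Lemma gen_ideal_capelli B S f : I f -> I (capelli B S f).
Proof.
have [n] := ubnP (size B); elim: n B S f => // n IH B S f.
case: B => [_ If|b B]; first by rewrite capelli_nil; case: S => // *; exact: gen_ideal0.
rewrite ltnS => sB If; rewrite capelli_peel; apply: gen_ideal_alt_sum => c S'.
apply: gen_idealB; first by apply: IH => //; exact: gen_ideal_polar.
apply: gen_ideal_alt_delete => B' sB'.
by apply: IH => //; apply: leq_trans sB.
Qed.

(** On a vector killed modulo I by the E_cb with c in B, only the diagonal entry and the
    normal ordering corrections of the column expansion survive, and the latter come with
    positive signs. *)
Lemma capelli_diag b B f n :
    b \notin B -> uniq B -> {in B, forall c, I (polar A c b f)} ->
    polar A b b f = n%:R *: f ->
  I (capelli (b :: B) (b :: B) f
     - (n%:R *: capelli B B f + sum_skip (fun L => capelli (b :: L) (b :: L) f) B)).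
Proof.
move=> bB uB hw Ebb; rewrite capelli_peel /= alt_delete_notin // subr0 Ebb linearZ /=.
rewrite alt_sumB (alt_sum_delete_diag (fun B' S' => capelli (b :: B') (b :: S') f)) //.
set u := alt_sum _ _; set v := sum_skip _ _; set w := _ *: _.
have -> : w - (u - v) - (w + v) = - u by ncring.
apply: gen_idealN.
by apply: gen_ideal_alt_sum_in => c cB S'; apply/gen_ideal_capelli/hw.
Qed.

End Capelli.

(** * Reduction to three letters *)

Section Highest.
Variables (K : fieldType) (A : free_algebra K).
Hypothesis charK0 : [pchar K] =i pred0.
Local Notation x := (letter A).
Local Notation I := (gen_ideal (@letter_relation K A)).
Implicit Types (f g : A) (B S : seq nat).

Lemma sum_skip_multiple (pos : Prop) f (G : seq nat -> A) B :
  (forall L, subseq L B -> (size L < size B)%N ->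
     exists2 n, pos -> (0 < n)%N & I (G L - n%:R *: f)) ->
  exists2 n, pos -> B != [::] -> (0 < n)%N & I (sum_skip G B - n%:R *: f).
Proof.
elim: B G => [|b B IH] G HG /=.
  by exists 0%N => //; rewrite scale0r subrr; exact: gen_ideal0.
have [n n_pos In] : exists2 n, pos -> (0 < n)%N & I (G B - n%:R *: f).
  by apply: HG => //; exact: subseq_cons.
have [m _ Im] : exists2 n, pos -> B != [::] -> (0 < n)%N &
    I (sum_skip (fun L => G (b :: L)) B - n%:R *: f).
  by apply: IH => L subL sL; apply: HG => //=; rewrite eqxx.
exists (n + m)%N; first by move=> p _; rewrite addn_gt0 n_pos.
by rewrite natrD scalerDl opprD addrACA; exact: gen_ideal_add.
Qed.

(** Only nonnegative terms are added in the recursion, so positivity of the scalar is seen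
    without computing the classical product formula for it: each step keeps the largest
    letter b, down to the term m b of the list [:: b]. *)
Lemma capelli_highest f (m : nat -> nat) :
    (forall b, polar A b b f = (m b)%:R *: f) ->
    (forall c b, (c < b)%N -> I (polar A c b f)) ->
  forall L, sorted gtn L ->
  exists2 n, (L = [::] \/ 0 < m (head 0 L))%N -> (0 < n)%N &
             I (capelli A L L f - n%:R *: f).
Proof.
move=> wt hw L; have [k] := ubnP (size L); elim: k L => // k IH [|b B] sL soL.
  by exists 1%N => //; rewrite capelli_nil scale1r subrr; exact: gen_ideal0.
have gtn_tr : transitive gtn by move=> p q r /= pq qr; exact: ltn_trans qr pq.
have /andP[/allP Blt soB] : all (gtn b) B && sorted gtn B.
  by rewrite -(path_sortedE gtn_tr).
have uB : uniq B by apply: sorted_uniq soB => // p; exact: ltnn.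
have bB : b \notin B by apply/negP => /Blt /=; rewrite ltnn.
have hwB : {in B, forall c, I (polar A c b f)} by move=> c /Blt; exact: hw.
have I1 := capelli_diag bB uB hwB (wt b).
have [n n_pos In] := IH B sL soB.
have [p p_pos Ip] : exists2 n, (0 < m b)%N -> B != [::] -> (0 < n)%N &
    I (sum_skip (fun L => capelli A (b :: L) (b :: L) f) B - n%:R *: f).
  apply: sum_skip_multiple => L subL ltL.
  have [|//|q q_pos Iq] := IH (b :: L); first exact: leq_ltn_trans ltL sL.
    apply: subseq_sorted soL => //=; rewrite eqxx //.
  by exists q => // mb; apply: q_pos; right.
exists (m b * n + p)%N => [[//|/= mb]|].
  case: B {I1 In Ip IH sL soL Blt soB uB bB hwB} n_pos p_pos => [n_pos _|c B _ p_pos].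
    by rewrite addn_gt0 muln_gt0 mb n_pos //; left.
  by rewrite addn_gt0 p_pos ?orbT.
move: (gen_ideal_add I1 (gen_ideal_add (gen_idealZ (m b)%:R In) Ip)).
congr I; rewrite natrD natrM scalerDl -scalerA scalerBr.
by set u := _ *: capelli _ _ _ _; set v := sum_skip _ _; ncring.
Qed.

Inductive homog (u : seq nat) : A -> Prop :=
| homog_word w : perm_eq w u -> homog u (word A w)
| homog0 : homog u 0
| homog_linear c f g : homog u f -> homog u g -> homog u (c *: f + g).

Lemma homog_letterM i u f : homog u f -> homog (i :: u) (x i * f).
Proof.
elim=> {f} [w wu||c f g _ Hf _ Hg].
- by rewrite -word_cons; apply: homog_word; rewrite perm_cons.
- by rewrite mulr0; exact: homog0.
- by rewrite mulrDr -scalerAr; exact: homog_linear.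
Qed.

Lemma homog_perm u v f : perm_eq u v -> homog u f -> homog v f.
Proof.
move=> uv; elim=> {f} [w wu||c f g _ Hf _ Hg].
- by apply: homog_word; exact: perm_trans wu uv.
- exact: homog0.
- exact: homog_linear.
Qed.

Lemma homogD u f g : homog u f -> homog u g -> homog u (f + g).
Proof. by rewrite -[f]scale1r; move=> Hf Hg; apply: homog_linear => //; rewrite -[f]scale1r. Qed.

Lemma polar_word_notin a b w : b \notin w -> polar A a b (word A w) = 0.
Proof.
elim: w => [|i w IH]; first by rewrite word_nil polar1.
rewrite inE negb_or eq_sym => /andP[/negbTE ib bw].
by rewrite word_cons polar_letterM IH // ib mulr0 addr0.
Qed.

Lemma homog_polar_word a b w : b \in w -> homog (a :: rem b w) (polar A a b (word A w)).
Proof.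
elim: w => // i w IH; rewrite inE word_cons polar_letterM /= eq_sym.
case: eqP => [-> _|_ /= bw]; rewrite ?mulr1n ?mulr0n.
  apply: homogD; last by rewrite -word_cons; exact: homog_word.
  have [bw|bw] := boolP (b \in w); last by rewrite polar_word_notin // mulr0; exact: homog0.
  apply: homog_perm (homog_letterM b (IH bw)).
  rewrite -[b :: a :: _]/([:: b] ++ [:: a] ++ _) perm_catCA /= perm_cons perm_sym.
  exact: perm_to_rem.
rewrite addr0; apply: homog_perm (homog_letterM i (IH bw)).
by rewrite -[i :: a :: _]/([:: i] ++ [:: a] ++ _) perm_catCA.
Qed.

Lemma homog_polar a b u f : b \in u -> homog u f -> homog (a :: rem b u) (polar A a b f).
Proof.
move=> bu; elim=> {f} [w wu||c f g _ Hf _ Hg].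
- have bw : b \in w by rewrite (perm_mem wu).
  apply: homog_perm (homog_polar_word a bw); rewrite perm_cons -(perm_cons b).
  by rewrite -(permPl (perm_to_rem bw)) -(permPr (perm_to_rem bu)).
- by rewrite linear0; exact: homog0.
- by rewrite linearP; exact: homog_linear.
Qed.

Lemma homog_polar_notin a b u f : b \notin u -> homog u f -> polar A a b f = 0.
Proof.
move=> bu; elim=> {f} [w wu||c f g _ Hf _ Hg].
- by apply: polar_word_notin; rewrite (perm_mem wu).
- by rewrite linear0.
- by rewrite linearP /= Hf Hg scaler0 addr0.
Qed.

Lemma homog_polar_diag b u f : homog u f -> polar A b b f = (count_mem b u)%:R *: f.
Proof.
elim=> {f} [w wu||c f g _ Hf _ Hg].
- rewrite -(elimT seq.permP wu (pred1 b)); elim: w {wu} => [|i w IH] /=.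
    by rewrite word_nil polar1 scale0r.
  rewrite word_cons polar_letterM IH natrD scalerDl addrC -scalerAr; congr (_ + _).
  by case: eqP => [->|_]; rewrite ?mulr1n ?mulr0n ?scale1r ?scale0r.
- by rewrite linear0 scaler0.
- by rewrite linearP /= Hf Hg scalerDr !scalerA mulrC.
Qed.

Lemma sumn_rem b u : b \in u -> (b + sumn (rem b u))%N = sumn u.
Proof. by move=> bu; rewrite [RHS](perm_sumn (perm_to_rem bu)). Qed.

(** E_cb with c < b lowers the sum of the letters, so that by induction f is a highest weight
    vector modulo I, on which the Capelli operator of i, 2, 1, 0 is a positive scalar. *)
Lemma reduction_to_three_letters (T : A -> Prop) :
    (forall a b f, T f -> T (polar A a b f)) ->
    (forall u f, all (fun i => i < 3)%N u -> homog u f -> T f -> I f) ->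
  forall u f, homog u f -> T f -> I f.
Proof.
move=> Tpolar T3 u f; have [n] := ubnP (sumn u).
elim: n u f => // n IH u f su Hf Tf.
have [u3|] := boolP (all (fun i => i < 3)%N u); first exact: T3 Hf Tf.
case/allPn=> i iu; rewrite -leqNgt => i3.
have lower c b : (c < b)%N -> I (polar A c b f).
  move=> cb; have [bu|bu] := boolP (b \in u); last first.
    by rewrite (homog_polar_notin c bu Hf); exact: gen_ideal0.
  apply: (IH (c :: rem b u)); [|exact: homog_polar|exact: Tpolar].
  by apply: leq_trans (su : (sumn u <= n)%N); rewrite -(sumn_rem bu) /= ltn_add2r.
have L4 : sorted gtn [:: i; 2; 1; 0]%N by rewrite /= i3.
have [k k_pos Ik] := capelli_highest (fun b => homog_polar_diag b Hf) lower L4.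
have k0 : k%:R != 0 :> K.
  rewrite ((pcharf0P K).1 charK0) -lt0n; apply: k_pos; right.
  by rewrite /= -has_count has_pred1.
rewrite -[f]scale1r -(mulVf k0) -scalerA; apply: gen_idealZ.
pose L := [:: i; 2; 1; 0]%N.
have := gen_idealB (capelli4_ideal charK0 L f (erefl : size L = 4)) Ik.
by rewrite opprB addrC subrK.
Qed.

End Highest.

(** * Vanishing on traceless matrices *)

Section Vanishing.
Variables (K : fieldType) (A : free_algebra K).
Hypothesis charK0 : [pchar K] =i pred0.
Local Notation x := (letter A).
Local Notation I := (gen_ideal (@letter_relation K A)).
Implicit Types (f : A) (s : seq nat).

Definition ev (R : algType K) (g : nat -> R) : {linear A -> R} :=
  lift_words A (fun s => \prod_(i <- s) g i).

Definition vanishes f : Prop :=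
  forall g : nat -> 'M[K]_2, (forall i, \tr (g i) = 0) -> ev g f = 0.

Lemma ev_word (R : algType K) (g : nat -> R) s : ev g (word A s) = \prod_(i <- s) g i.
Proof. by rewrite /ev lift_word. Qed.

Lemma ev1 (R : algType K) (g : nat -> R) : ev g 1 = 1.
Proof. by rewrite -(word_nil A) ev_word big_nil. Qed.

Lemma evM (R : algType K) (g : nat -> R) f h : ev g (f * h) = ev g f * ev g h.
Proof.
elim/word_ind: f => [|c f1 f2 IH1 IH2|s].
- by rewrite mul0r linear0 mul0r.
- by rewrite mulrDl -scalerAl !linearP /= IH1 IH2 mulrDl -scalerAl.
elim/word_ind: h => [|c f1 f2 IH1 IH2|t].
- by rewrite mulr0 linear0 mulr0.
- by rewrite mulrDr -scalerAr !linearP /= IH1 IH2 mulrDr -scalerAr.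
by rewrite -word_cat !ev_word big_cat.
Qed.

Lemma evX (R : algType K) (g : nat -> R) f n : ev g (f ^+ n) = ev g f ^+ n.
Proof. by elim: n => [|n IH]; rewrite ?expr0 ?ev1 // !exprS evM IH. Qed.

Lemma ev_letter (R : algType K) (g : nat -> R) i : ev g (x i) = g i.
Proof. by rewrite -word1 ev_word big_seq1. Qed.

Definition evpoly (g : nat -> 'M[{poly K}]_2) i j : {linear A -> {poly K}} :=
  lift_words A (fun s => (\prod_(k <- s) g k) i j).

Lemma poly_eq0_char0 (p : {poly K}) : (forall t, p.[t] = 0) -> p = 0.
Proof.
move=> p0; apply/eqP/contraT => nzp.
pose rs := [seq i%:R : K | i <- iota 0 (size p)].
have urs : uniq rs.
  rewrite map_inj_uniq ?iota_uniq // => i j.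
  wlog ij : i j / (i <= j)%N.
    by move=> W eqij; case: (leqP i j) => [|/ltnW] ij; [|apply/esym]; apply: W.
  move/eqP; rewrite eq_sym -subr_eq0 -natrB // ((pcharf0P K).1 charK0) subn_eq0 => ji.
  by apply/eqP; rewrite eqn_leq ij.
have := max_poly_roots nzp _ urs.
by rewrite size_map size_iota ltnn; apply; apply/allP => t _; apply/rootP.
Qed.

Lemma evpoly_horner g i j f t :
  (evpoly g i j f).[t] = ev (fun k => map_mx (horner_eval t) (g k)) f i j.
Proof.
elim/word_ind: f => [|c f1 f2 IH1 IH2|s].
- by rewrite !linear0 horner0 mxE.
- by rewrite !linearP /= hornerD hornerZ IH1 IH2 !mxE.
rewrite /evpoly lift_word ev_word.
have -> : \prod_(k <- s) map_mx (horner_eval t) (g k) =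
    map_mx (horner_eval t) (\prod_(k <- s) g k) by rewrite rmorph_prod.
by rewrite mxE.
Qed.

(** K is infinite, so identities on matrices over K extend to matrices over K[X]; the
    coefficients in X then yield new identities over K. *)
Lemma vanishes_poly f (g : nat -> 'M[{poly K}]_2) i j :
  vanishes f -> (forall k, \tr (g k) = 0) -> evpoly g i j f = 0.
Proof.
move=> vf g0; apply: poly_eq0_char0 => t.
rewrite evpoly_horner vf ?mxE // => k.
by rewrite trace_map_mx g0 rmorph0.
Qed.

(** Coefficient of X in the identity evaluated with g_b replaced by g_b + X g_a. *)
Lemma vanishes_polar a b f : vanishes f -> vanishes (polar A a b f).
Proof.
move=> vf g g0; pose C (M : 'M[K]_2) := map_mx polyC M.
pose g' k := C (g k) + ('X *: C (g a)) *+ (k == b).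
have g'0 k : \tr (g' k) = 0.
  rewrite /g' linearD linearMn /= linearZ /= !trace_map_mx !g0 !rmorph0 mulr0 mul0rn.
  by rewrite addr0.
have coef s i j : ((\prod_(k <- s) g' k) i j)`_0 = (\prod_(k <- s) g k) i j /\
   ((\prod_(k <- s) g' k) i j)`_1 = (ev g (polar A a b (word A s))) i j.
  elim: s i j => [|k s IH] i j.
    rewrite !big_nil word_nil polar1 linear0 !mxE; case: (i == j); by rewrite ?coef1 ?coef0.
  have g'k0 u v : (g' k u v)`_0 = g k u v.
    rewrite /g' !mxE coefD coefC /=; case: (k == b); rewrite ?mulr1n ?mulr0n !mxE ?coefXM.
      by rewrite addr0.
    by rewrite coef0 addr0.
  have g'k1 u v : (g' k u v)`_1 = g a u v *+ (k == b).
    rewrite /g' !mxE coefD coefC /= add0r; case: (k == b); rewrite ?mulr1n ?mulr0n !mxE.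
      by rewrite coefXM coefC.
    by rewrite coef0.
  rewrite !big_cons word_cons polar_letterM linearD raddfMn /= !evM !ev_letter !mxE.
  split.
    rewrite coef_sum; apply: eq_bigr => l _.
    by rewrite coefM big_ord1 /= g'k0 (IH l j).1.
  rewrite coef_sum ev_word.
  have -> : (g a * \prod_(j0 <- s) g j0 *+ (k == b)) i j =
      \sum_l (g a i l *+ (k == b)) * (\prod_(j0 <- s) g j0) l j.
    rewrite -mulrnAl mxE; apply: eq_bigr => l _; congr (_ * _).
    by case: (k == b); rewrite ?mulr1n ?mulr0n ?mxE.
  rewrite -big_split; apply: eq_bigr => l _ /=.
  rewrite coefM big_ord_recl big_ord1 /= g'k0 g'k1.
  by rewrite (IH l j).2 (IH l j).1 addrC.
have coef1f i j h : (evpoly g' i j h)`_1 = (ev g (polar A a b h)) i j.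
  elim/word_ind: h => [|c f1 f2 IH1 IH2|s].
  - by rewrite !linear0 coef0 mxE.
  - by rewrite !linearP /= coefD coefZ IH1 IH2 !mxE.
  by rewrite /evpoly lift_word (coef s i j).2.
by apply/matrixP => i j; rewrite -coef1f vanishes_poly // coef0 mxE.
Qed.

Definition component j k : {linear A -> A} :=
  lift_words A (fun s => word A s *+ (count_mem j s == k)).

(** Coefficient of X^k in the identity evaluated with g_j replaced by X g_j. *)
Lemma vanishes_component j k f : vanishes f -> vanishes (component j k f).
Proof.
move=> vf g g0; pose C (M : 'M[K]_2) := map_mx polyC M.
pose g' i := 'X^(i == j) *: C (g i).
have g'0 i : \tr (g' i) = 0.
  by rewrite /g' linearZ /= trace_map_mx g0 rmorph0 mulr0.
have g'word s : \prod_(i <- s) g' i = 'X^(count_mem j s) *: C (\prod_(i <- s) g i).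
  elim: s => [|i s IH] /=; first by rewrite !big_nil scale1r /C rmorph1.
  rewrite !big_cons IH /g' -scalerAl -scalerAr scalerA -exprD; congr (_ *: _).
  by rewrite /C rmorphM.
have coefk u v h : (evpoly g' u v h)`_k = (ev g (component j k h)) u v.
  elim/word_ind: h => [|c f1 f2 IH1 IH2|s].
  - by rewrite !linear0 coef0 mxE.
  - by rewrite !linearP /= coefD coefZ IH1 IH2 !mxE.
  rewrite /evpoly /component !lift_word g'word !mxE mulrC coefCM coefXn raddfMn /= ev_word.
  by rewrite eq_sym; case: (_ == k); rewrite ?mulr1 ?mulr0 ?mxE.
by apply/matrixP => u v; rewrite -coefk vanishes_poly // coef0 mxE.
Qed.

End Vanishing.

(** * Multihomogeneous components *)

Section Decomposition.
Variables (K : fieldType) (A : free_algebra K).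
Hypothesis charK0 : [pchar K] =i pred0.
Local Notation x := (letter A).
Local Notation I := (gen_ideal (@letter_relation K A)).
Implicit Types (f : A) (s : seq nat).

Inductive word_span (Q : pred (seq nat)) : A -> Prop :=
| word_span_word s : Q s -> word_span Q (word A s)
| word_span0 : word_span Q 0
| word_span_linear c f g : word_span Q f -> word_span Q g -> word_span Q (c *: f + g).

Lemma word_span_sub (Q Q' : pred (seq nat)) f :
  (forall s, Q s -> Q' s) -> word_span Q f -> word_span Q' f.
Proof.
move=> QQ'; elim=> {f} [s /QQ'||c f g _ Hf _ Hg].
- exact: word_span_word.
- exact: word_span0.
- exact: word_span_linear.
Qed.

Lemma homog_word_span u f : word_span (fun s => perm_eq s u) f -> homog u f.
Proof.
elim=> {f} [s su||c f g _ Hf _ Hg]; first exact: homog_word.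
  exact: homog0.
exact: homog_linear.
Qed.

Lemma word_span_bounded f : exists m, word_span (all (fun i => i < m)%N) f.
Proof.
elim/word_ind: f => [|c f g [m Hf] [n Hg]|s].
- by exists 0%N; exact: word_span0.
- exists (maxn m n); apply: word_span_linear.
    by apply: word_span_sub Hf => s; apply: sub_all => i im; rewrite leq_max im.
  by apply: word_span_sub Hg => s; apply: sub_all => i im; rewrite leq_max im orbT.
- exists (\max_(i <- s) i).+1; apply: word_span_word; apply/allP => i i_s.
  by rewrite ltnS; apply: leq_bigmax_seq.
Qed.

Lemma component_word_span Q j k f :
  word_span Q f -> word_span (fun s => Q s && (count_mem j s == k)) (component A j k f).
Proof.
elim=> {f} [s Qs||c f g _ Hf _ Hg].
- rewrite /component lift_word; case: eqP => [cj|_]; rewrite ?mulr1n ?mulr0n.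
    by apply: word_span_word; rewrite Qs cj eqxx.
  exact: word_span0.
- by rewrite linear0; exact: word_span0.
- by rewrite linearP; exact: word_span_linear.
Qed.

Lemma sum_component j f :
  exists N, forall n, (N <= n)%N -> f = \sum_(k < n) component A j k f.
Proof.
elim/word_ind: f => [|c f g [m Hf] [n Hg]|s].
- by exists 0%N => n _; rewrite big1 // => k _; rewrite linear0.
- exists (maxn m n) => p; rewrite geq_max => /andP[mp np].
  rewrite {1}(Hf p mp) {1}(Hg p np) scaler_sumr -big_split; apply: eq_bigr => k _.
  by rewrite linearP.
- exists (count_mem j s).+1 => n sn; rewrite (bigD1 (Ordinal sn)) //= big1 ?addr0.
    by rewrite /component lift_word eqxx mulr1n.
  move=> k neq; rewrite /component lift_word; case: eqP => // ek.
  by move/eqP: neq; case; apply/val_inj.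
Qed.

Lemma perm_eq_bounded m s u :
  all (fun i => i < m)%N s -> all (fun i => i < m)%N u ->
  (forall i, (i < m)%N -> count_mem i s = count_mem i u) -> perm_eq s u.
Proof.
move=> /allP sm /allP um eqc; rewrite /perm_eq; apply/allP => i.
by rewrite mem_cat => /orP[/sm|/um] im; apply/eqP; exact: eqc.
Qed.

Fixpoint multiset_of (m : nat) (lambda : nat -> nat) : seq nat :=
  if m is k.+1 then nseq (lambda k) k ++ multiset_of k lambda else [::].

Lemma all_multiset_of m lambda : all (fun i => i < m)%N (multiset_of m lambda).
Proof.
elim: m => //= m IH; rewrite all_cat all_nseq ltnSn orbT /=.
by apply: sub_all IH => i /ltnW.
Qed.

Lemma count_multiset_of m lambda i :
  (i < m)%N -> count_mem i (multiset_of m lambda) = lambda i.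
Proof.
elim: m => //= m IH; rewrite ltnS leq_eqVlt count_cat count_nseq /=.
case: eqP => [->|_] /= im; last by rewrite eq_sym (ltn_eqF im) IH // mul0n.
rewrite eqxx mul1n (_ : count_mem m _ = 0%N) ?addn0 //.
apply/eqP; rewrite -leqn0 leqNgt -has_count; apply/hasPn => k.
by move/(allP (all_multiset_of m lambda)) => /= /ltn_eqF ->.
Qed.

(** Splitting successively according to the multiplicity of each letter. *)
Lemma vanishes_homog_ind f :
  (forall u g, homog u g -> vanishes g -> I g) -> vanishes f -> I f.
Proof.
move=> Ihomog vf; have [m Hf] := word_span_bounded f.
pose Q j (lambda : nat -> nat) (s : seq nat) :=
  all (fun i => i < m)%N s && all (fun i => count_mem i s == lambda i) (iota 0 j).
suff IQ d : forall j lambda g, (j + d)%N = m -> vanishes g -> word_span (Q j lambda) g -> I g.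
  apply: (IQ m 0%N (fun=> 0%N)) => //.
  by apply: word_span_sub Hf => s; rewrite /Q /= andbT.
elim: d => [|d IH] j lambda g jd vg Qg.
  rewrite addn0 in jd; rewrite {j}jd in Qg.
  apply: (Ihomog (multiset_of m lambda)) => //; apply: homog_word_span.
  apply: word_span_sub Qg => s /andP[sm /allP cs].
  apply: (perm_eq_bounded sm (all_multiset_of m lambda)) => i im.
  by rewrite count_multiset_of //; apply/eqP/cs; rewrite mem_iota.
have [N Hg] := sum_component j g.
rewrite (Hg N (leqnn N)); apply: gen_ideal_sum => k _.
apply: (IH j.+1 (fun i => if i == j then k : nat else lambda i)).
- by rewrite addSnnS.
- exact: vanishes_component.
- apply: word_span_sub (component_word_span j k Qg) => s /andP[/andP[sm /allP cs] cj].
  rewrite /Q sm andTb; apply/allP => i; rewrite mem_iota leq0n add0n ltnS andTb leq_eqVlt.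
  case: eqP => [->|_] //= ij.
  by apply: cs; rewrite mem_iota.
Qed.

End Decomposition.

(** * Ordered monomials in three letters *)

Section Monomials.
Variables (K : fieldType) (A : free_algebra K).
Hypothesis charK0 : [pchar K] =i pred0.
Local Notation x := (letter A).
Local Notation I := (gen_ideal (@letter_relation K A)).
Local Notation t := (gram A).
Implicit Types (f : A) (s : seq nat).

Definition exponents : Type := (nat * nat * nat) * (nat * nat * nat).

Definition ordered_mon (R : pzRingType) (g : nat -> R) (e : exponents) : R :=
  let: ((a, b, c), (d, p, q)) := e in
  g 0 ^+ a * (g 1 ^+ b * (g 2 ^+ c *
   (anticomm (g 0) (g 1) ^+ d * (anticomm (g 0) (g 2) ^+ p * anticomm (g 1) (g 2) ^+ q)))).

Inductive mon_span : A -> Prop :=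
| mon_span_mon e : mon_span (ordered_mon x e)
| mon_span0 : mon_span 0
| mon_span_linear c f g : mon_span f -> mon_span g -> mon_span (c *: f + g)
| mon_span_congr f g : I (f - g) -> mon_span f -> mon_span g.

Lemma mon_spanB f g : mon_span f -> mon_span g -> mon_span (f - g).
Proof. by move=> Hf Hg; rewrite addrC -scaleN1r; exact: mon_span_linear. Qed.

Lemma mon_span_mull (y : A) :
  (forall e, mon_span (y * ordered_mon x e)) -> forall f, mon_span f -> mon_span (y * f).
Proof.
move=> Hy f; elim=> {f} [e||c f g _ Hf _ Hg|f g Ifg _ Hf] //.
- by rewrite mulr0; exact: mon_span0.
- by rewrite mulrDr -scalerAr; exact: mon_span_linear.
- by apply: mon_span_congr Hf; rewrite -mulrBr; exact: gen_ideal_mull.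
Qed.

Lemma gram_swap i j (u v : A) : I (u * (t i j * v) - t i j * (u * v)).
Proof.
rewrite !mulrA -mulrBl -opprB mulNr.
by apply/gen_idealN/gen_ideal_mulr/gram_central.
Qed.

Lemma mon_span_gram01 f : mon_span f -> mon_span (t 0 1 * f).
Proof.
apply: mon_span_mull => -[[[a b] c] [[d p] q]].
apply: mon_span_congr (mon_span_mon ((a, b, c), (d.+1, p, q))).
have := gram_swap 0 1 (x 0 ^+ a * x 1 ^+ b * x 2 ^+ c) (t 0 1 ^+ d * (t 0 2 ^+ p * t 1 2 ^+ q)).
by rewrite /= exprS !mulrA.
Qed.

Lemma mon_span_gram02 f : mon_span f -> mon_span (t 0 2 * f).
Proof.
apply: mon_span_mull => -[[[a b] c] [[d p] q]].
apply: mon_span_congr (mon_span_mon ((a, b, c), (d, p.+1, q))).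
have := gram_swap 0 2 (x 0 ^+ a * x 1 ^+ b * x 2 ^+ c * t 0 1 ^+ d) (t 0 2 ^+ p * t 1 2 ^+ q).
by rewrite /= exprS !mulrA.
Qed.

Lemma mon_span_gram12 f : mon_span f -> mon_span (t 1 2 * f).
Proof.
apply: mon_span_mull => -[[[a b] c] [[d p] q]].
apply: mon_span_congr (mon_span_mon ((a, b, c), (d, p, q.+1))).
have := gram_swap 1 2 (x 0 ^+ a * x 1 ^+ b * x 2 ^+ c * t 0 1 ^+ d * t 0 2 ^+ p) (t 1 2 ^+ q).
by rewrite /= exprS !mulrA.
Qed.

(** Sorting a word: each exchange of letters produces a factor t, central modulo I. *)
Lemma swap_letters i j (f : A) : x j * (x i * f) = t i j * f - x i * (x j * f).
Proof. by rewrite /gram /anticomm; ncring. Qed.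

Lemma mon_span_x0 f : mon_span f -> mon_span (x 0 * f).
Proof.
apply: mon_span_mull => -[[[a b] c] [[d p] q]].
rewrite (_ : _ * _ = ordered_mon x ((a.+1, b, c), (d, p, q))); first exact: mon_span_mon.
by rewrite /= exprS !mulrA.
Qed.

Lemma mon_span_x1 f : mon_span f -> mon_span (x 1 * f).
Proof.
apply: mon_span_mull => -[[[a b] c] [[d p] q]]; elim: a => [|a IH].
  rewrite (_ : _ * _ = ordered_mon x ((0, b.+1, c), (d, p, q))%N); first exact: mon_span_mon.
  by rewrite /= expr0 !mul1r exprS !mulrA.
rewrite (_ : ordered_mon x _ = x 0 * ordered_mon x ((a, b, c), (d, p, q))); last first.
  by rewrite /= exprS !mulrA.
rewrite swap_letters; apply: mon_spanB.
  by apply: mon_span_gram01; exact: mon_span_mon.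
exact: mon_span_x0.
Qed.

Lemma mon_span_x2 f : mon_span f -> mon_span (x 2 * f).
Proof.
apply: mon_span_mull => -[[[a b] c] [[d p] q]]; elim: a => [|a IH].
  elim: b => [|b IH].
    rewrite (_ : _ * _ = ordered_mon x ((0, 0, c.+1), (d, p, q))%N); first exact: mon_span_mon.
    by rewrite /= expr0 !mul1r exprS !mulrA.
  rewrite (_ : ordered_mon x _ = x 1 * ordered_mon x ((0, b, c), (d, p, q))%N); last first.
    by rewrite /= expr0 !mul1r exprS !mulrA.
  rewrite swap_letters; apply: mon_spanB.
    by apply: mon_span_gram12; exact: mon_span_mon.
  exact: mon_span_x1.
rewrite (_ : ordered_mon x _ = x 0 * ordered_mon x ((a, b, c), (d, p, q))); last first.
  by rewrite /= exprS !mulrA.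
rewrite swap_letters; apply: mon_spanB.
  by apply: mon_span_gram02; exact: mon_span_mon.
exact: mon_span_x0.
Qed.

Lemma mon_span_word s : all (fun i => i < 3)%N s -> mon_span (word A s).
Proof.
elim: s => [_|i s IH /= /andP[i3 /IH Hs]].
  rewrite word_nil (_ : 1 = ordered_mon x ((0, 0, 0), (0, 0, 0))%N); first exact: mon_span_mon.
  by rewrite /= !mulr1.
rewrite word_cons; case: i i3 => [|[|[|//]]] _.
- exact: mon_span_x0.
- exact: mon_span_x1.
- exact: mon_span_x2.
Qed.

Lemma mon_span_homog u f : all (fun i => i < 3)%N u -> homog u f -> mon_span f.
Proof.
move=> u3; elim=> {f} [w wu||c f g _ Hf _ Hg].
- by apply: mon_span_word; rewrite (perm_all _ wu).
- exact: mon_span0.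
- exact: mon_span_linear.
Qed.

Lemma mon_span_sum f : mon_span f ->
  exists l : seq (K * exponents), I (f - \sum_(p <- l) p.1 *: ordered_mon x p.2).
Proof.
elim=> {f} [e||c f g _ [l Hf] _ [m Hg]|f g Ifg _ [l Hf]].
- by exists [:: (1, e)]; rewrite big_seq1 scale1r subrr; exact: gen_ideal0.
- by exists [::]; rewrite big_nil subrr; exact: gen_ideal0.
- exists ([seq (c * p.1, p.2) | p <- l] ++ m); rewrite big_cat big_map /=.
  rewrite -(eq_bigr _ (fun p _ => scalerA _ _ _)) -scaler_sumr opprD addrACA -scalerBr.
  by apply: gen_ideal_add => //; exact: gen_idealZ.
- exists l; rewrite -(subrKA f); apply: gen_ideal_add => //.
  by rewrite -opprB; exact: gen_idealN.
Qed.

End Monomials.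

(** * Linear independence of ordered monomials *)

Section LeadingTerm.
Variable K : fieldType.
Local Notation M := 'M[{poly K}]_2.
Local Notation C := (map_mx (@polyC K)).
Local Notation at0 := (map_mx (horner_eval (0 : K))).
Implicit Types (P Q : M) (p q : 'M[K]_2).

(** P = X^k Q with Q(0) = p: unless p = 0, p is the coefficient of lowest order of P. *)
Definition has_lead (k : nat) p P := exists2 Q, P = 'X^k *: Q & at0 Q = p.

Lemma lead_const k p : has_lead k p ('X^k *: C p).
Proof.
exists (C p) => //; apply/matrixP => i j; rewrite !mxE /horner_eval hornerC //.
Qed.

Lemma leadM k l p q P Q : has_lead k p P -> has_lead l q Q -> has_lead (k + l) (p * q) (P * Q).
Proof.
move=> [P' -> <-] [Q' -> <-]; exists (P' * Q'); last by rewrite rmorphM.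
by rewrite -scalerAl -scalerAr scalerA exprD.
Qed.

Lemma leadX k p P n : has_lead k p P -> has_lead (k * n) (p ^+ n) (P ^+ n).
Proof.
move=> H; elim: n => [|n IH].
  by exists 1; rewrite ?muln0 ?scale1r ?rmorph1.
by rewrite mulnS !exprS; exact: leadM.
Qed.

Lemma lead_addr k l p P Q : (k < l)%N -> has_lead k p P -> has_lead k p (P + 'X^l *: Q).
Proof.
move=> kl [P' -> <-]; exists (P' + 'X^(l - k) *: Q).
  by rewrite scalerDr scalerA -exprD subnKC // ltnW.
apply/matrixP => i j; rewrite !mxE /horner_eval hornerD hornerM hornerXn.
by rewrite expr0n subn_eq0 leqNgt kl mul0r addr0.
Qed.

(** In a vanishing sum, the coefficients of lowest order cancel. *)
Lemma lead_sum0 (T : eqType) (r : seq T) (c : T -> K) (k : T -> nat) (p : T -> 'M[K]_2)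
    (P : T -> M) m :
    (forall e, e \in r -> has_lead (k e) (p e) (P e)) ->
    (forall e, e \in r -> m <= k e)%N ->
    \sum_(e <- r) (c e)%:P *: P e = 0 ->
  \sum_(e <- r | k e == m) c e *: p e = 0.
Proof.
move=> ld km sum0.
have coefm e : e \in r -> map_mx (coefp m) (P e) = p e *+ (k e == m).
  move=> er; have [Q -> <-] := ld e er.
  apply/matrixP => i j; rewrite !mxE /= coefXnM.
  have := km e er; rewrite leq_eqVlt eq_sym; case: eqP => [->|_ /= mk].
    by rewrite ltnn subnn mulr1n mxE /horner_eval horner_coef0.
  by rewrite mk mulr0n mxE.
rewrite big_mkcond /=; transitivity (map_mx (coefp m) (\sum_(e <- r) (c e)%:P *: P e)).
  rewrite raddf_sum /= !big_seq; apply: eq_bigr => e er.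
  have -> : map_mx (coefp m) ((c e)%:P *: P e) = c e *: map_mx (coefp m) (P e).
    by apply/matrixP => i j; rewrite !mxE /= coefCM.
  by rewrite coefm //; case: (k e == m); rewrite ?mulr1n ?mulr0n ?scaler0.
by rewrite sum0 raddf0.
Qed.

End LeadingTerm.

Section Witness.
Variables (K : fieldType) (n : nat).
Hypothesis charK0 : [pchar K] =i pred0.
Hypothesis n1 : (1 < n)%N.
Local Notation C := (map_mx (@polyC K)).

Definition mat_h : 'M[K]_2 := \matrix_(i, j) ((-1) ^+ i *+ (i == j)).
Definition mat_s : 'M[K]_2 := \matrix_(i, j) (i != j)%:R.
Definition mat_r : 'M[K]_2 := mat_h * mat_s.

Lemma mat_h2 : mat_h * mat_h = 1.
Proof.
apply/matrixP => i j; rewrite !mxE !big_ord_recl big_ord0 !mxE /=.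
by case: i => [[|[|//]] ?]; case: j => [[|[|//]] ?] /=; rewrite /eq_op /= /bump /=; ring.
Qed.

Lemma mat_s2 : mat_s * mat_s = 1.
Proof.
apply/matrixP => i j; rewrite !mxE !big_ord_recl big_ord0 !mxE /=.
by case: i => [[|[|//]] ?]; case: j => [[|[|//]] ?] /=; rewrite /eq_op /= /bump /=; ring.
Qed.

Lemma mat_s_h : mat_s * mat_h = - (mat_h * mat_s).
Proof.
apply/matrixP => i j; rewrite !mxE !big_ord_recl !big_ord0 !mxE /=.
by case: i => [[|[|//]] ?]; case: j => [[|[|//]] ?] /=; rewrite /eq_op /= /bump /=; ring.
Qed.

(** The exponents of X are chosen so that x_0, x_1, x_2, t_01, t_02, t_12 have the orders
    n, 1, n^2, n + n^5, n + n^4, 1 + n^3: the order of an ordered monomial then has its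
    exponents, or sums of two or three of them, as its digits in base n. *)
Definition witness (i : nat) : 'M[{poly K}]_2 :=
  match i with
  | 0 => 'X^n *: C mat_h
  | 1 => 'X^1 *: C mat_s + 'X^(n ^ 5) *: C mat_h
  | 2 => 'X^(n ^ 2) *: C mat_r + 'X^(n ^ 3) *: C mat_s + 'X^(n ^ 4) *: C mat_h
  | _ => 0
  end.

Lemma trace_mat_h : \tr mat_h = 0.
Proof. by rewrite /mxtrace !big_ord_recl big_ord0 !mxE /= /bump /=; ring. Qed.

Lemma trace_mat_s : \tr mat_s = 0.
Proof. by rewrite /mxtrace !big_ord_recl big_ord0 !mxE /= /bump /=; ring. Qed.

Lemma trace_mat_r : \tr mat_r = 0.
Proof.
by rewrite /mxtrace !big_ord_recl big_ord0 !mxE /= !big_ord_recl !big_ord0 !mxE /= /bump /=; ring.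
Qed.

Lemma trace_witness i : \tr (witness i) = 0.
Proof.
have tC k p : \tr p = 0 -> \tr ('X^k *: C p) = 0.
  by move=> p0; rewrite linearZ /= trace_map_mx p0 rmorph0 mulr0.
case: i => [|[|[|i]]] /=; rewrite ?linearD /= ?tC ?addr0 //.
- exact: trace_mat_h.
- exact: trace_mat_h.
- exact: trace_mat_s.
- exact: trace_mat_h.
- exact: trace_mat_s.
- exact: trace_mat_r.
- exact: linear0.
Qed.

Definition order_of (e : exponents) : nat :=
  let: ((a, b, c), (d, p, q)) := e in
  ((b + q) + n * ((a + d + p) + n * (c + n * (q + n * (p + n * d)))))%N.

Definition lead_of (e : exponents) : 'M[K]_2 :=
  let: ((a, b, c), (d, p, q)) := e in
  mat_h ^+ a * (mat_s ^+ b * (mat_r ^+ c * (2%:R ^+ d * (2%:R ^+ p * 2%:R ^+ q)))).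

(** h, s and hs anticommute pairwise, so only products of equal ones contribute to the t_ij,
    and the leading coefficients of the t_ij are scalar. *)
Lemma lead_ordered_mon e : has_lead (order_of e) (lead_of e) (ordered_mon witness e).
Proof.
have n2 : (n ^ 2 = n * n)%N by rewrite -mulnn.
have n3 : (n ^ 3 = n * (n * n))%N by rewrite expnS n2.
have n4 : (n ^ 4 = n * (n * (n * n)))%N by rewrite expnS n3.
have n5 : (n ^ 5 = n * (n * (n * (n * n))))%N by rewrite expnS n4.
have lt12 : (n ^ 2 < n ^ 3)%N by rewrite ltn_exp2l.
have lt24 : (n ^ 2 < n ^ 4)%N by rewrite ltn_exp2l.
have lt35 : (n ^ 3 < n ^ 5)%N by rewrite ltn_exp2l.
have lt05 : (1 < n ^ 5)%N by rewrite -(expn0 n) ltn_exp2l.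
have lt04 : (1 < n ^ 4)%N by rewrite -(expn0 n) ltn_exp2l.
have CM p q : C p * C q = C (p * q) by rewrite rmorphM.
have acX (k l : nat) p q : anticomm ('X^k *: C p) ('X^l *: C q) = 'X^(k + l) *: C (anticomm p q).
  rewrite /anticomm -!scalerAl -!scalerAr !scalerA -!exprD !CM rmorphD /= scalerDr.
  by rewrite (addnC l k).
have acD (R : pzRingType) (u v w : R) : anticomm u (v + w) = anticomm u v + anticomm u w.
  by rewrite /anticomm; ncring.
have acDl (R : pzRingType) (u v w : R) : anticomm (u + v) w = anticomm u w + anticomm v w.
  by rewrite /anticomm; ncring.
have hh : anticomm mat_h mat_h = 2%:R by rewrite /anticomm mat_h2.
have ss : anticomm mat_s mat_s = 2%:R by rewrite /anticomm mat_s2.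
have hs : anticomm mat_h mat_s = 0 by rewrite /anticomm mat_s_h subrr.
have sh : anticomm mat_s mat_h = 0 by rewrite /anticomm mat_s_h addNr.
have hr : anticomm mat_h mat_r = 0.
  by rewrite /anticomm /mat_r -mulrA mat_s_h mulrN subrr.
have sr : anticomm mat_s mat_r = 0.
  by rewrite /anticomm /mat_r mulrA mat_s_h mulNr addNr.
have C0 : C (0 : 'M[K]_2) = 0 by apply/matrixP => i j; rewrite !mxE.
have g0 : has_lead n mat_h (witness 0) by exact: lead_const.
have g1 : has_lead 1 mat_s (witness 1) by apply: lead_addr => //; exact: lead_const.
have g2 : has_lead (n ^ 2) mat_r (witness 2).
  by apply: lead_addr => //; apply: lead_addr => //; exact: lead_const.
have t01 : has_lead (n + n ^ 5) 2%:R (anticomm (witness 0) (witness 1)).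
  by rewrite /= acD !acX hs hh C0 scaler0 add0r; exact: lead_const.
have t02 : has_lead (n + n ^ 4) 2%:R (anticomm (witness 0) (witness 2)).
  by rewrite /= !acD !acX hr hs hh C0 !scaler0 !add0r; exact: lead_const.
have t12 : has_lead (1 + n ^ 3) 2%:R (anticomm (witness 1) (witness 2)).
  rewrite /= acDl !acD !acX sr ss sh hr hs hh C0 !scaler0 !add0r !addr0.
  by apply: lead_addr; [lia|exact: lead_const].
case: e => [[[a b] c] [[d p] q]] /=.
have := leadM (leadX a g0) (leadM (leadX b g1) (leadM (leadX c g2)
  (leadM (leadX d t01) (leadM (leadX p t02) (leadX q t12))))).
by congr has_lead; rewrite n5 n4 n3 n2; ring.
Qed.

Lemma lead_of_unit e : lead_of e \is a GRing.unit.
Proof.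
have uM (p q : 'M[K]_2) : p \is a GRing.unit -> q \is a GRing.unit -> p * q \is a GRing.unit.
  by move=> up uq; rewrite unitrMl.
have uh : mat_h \is a GRing.unit by apply/unitrP; exists mat_h; rewrite mat_h2.
have us : mat_s \is a GRing.unit by apply/unitrP; exists mat_s; rewrite mat_s2.
have ur : mat_r \is a GRing.unit by exact: uM.
have u2 : (2%:R : 'M[K]_2) \is a GRing.unit.
  rewrite -(rmorph_nat (@scalar_mx K 2)) rmorph_unit // unitfE.
  by rewrite ((pcharf0P K).1 charK0).
case: e => [[[a b] c] [[d p] q]] /=.
by rewrite !unitrMl ?unitrX // !uM ?unitrX.
Qed.

Definition total (e : exponents) : nat :=
  let: ((a, b, c), (d, p, q)) := e in (a + b + c + d + p + q)%N.

Lemma digit_inj x y x' y' : (x < n)%N -> (x' < n)%N ->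
  (x + n * y = x' + n * y')%N -> x = x' /\ y = y'.
Proof.
move=> xn xn'; rewrite ![(_ + n * _)%N]addnC ![(n * _)%N]mulnC => E.
have n0 : (0 < n)%N by exact: leq_ltn_trans xn.
have := congr1 (modn^~ n) E; have := congr1 (divn^~ n) E.
by rewrite /= !modnMDl !divnMDl // !divn_small // !modn_small // !addn0.
Qed.

Lemma order_of_inj e e' : (total e < n)%N -> (total e' < n)%N ->
  order_of e = order_of e' -> e = e'.
Proof.
case: e => [[[a b] c] [[d p] q]]; case: e' => [[[a' b'] c'] [[d' p'] q']] /= te te'.
case/digit_inj; [lia|lia|move=> e1].
case/digit_inj; [lia|lia|move=> e2].
case/digit_inj; [lia|lia|move=> e3].
case/digit_inj; [lia|lia|move=> e4].
case/digit_inj; [lia|lia|move=> e5 e6].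
have -> : a = a' by lia.
have -> : b = b' by lia.
by rewrite e3 e4 e5 e6.
Qed.

End Witness.

Lemma exists_argmin (T : eqType) (k : T -> nat) (r : seq T) :
  r != [::] -> exists2 a, a \in r & forall b, b \in r -> (k a <= k b)%N.
Proof.
elim: r => // a r IH _; have [->|/IH [b br bmin]] := eqVneq r [::].
  by exists a; rewrite ?mem_head // => b; rewrite inE => /eqP ->.
have [ab|ba] := leqP (k a) (k b).
  exists a; first exact: mem_head.
  move=> d; rewrite inE => /predU1P[-> //|/bmin]; exact: leq_trans.
exists b; first by rewrite inE br orbT.
by move=> d; rewrite inE => /predU1P[->|/bmin //]; exact: ltnW.
Qed.

Section Independence.
Variables (K : fieldType) (A : free_algebra K).
Hypothesis charK0 : [pchar K] =i pred0.
Local Notation x := (letter A).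
Local Notation I := (gen_ideal (@letter_relation K A)).

Lemma ev_ordered_mon (R : algType K) (g : nat -> R) e : ev A g (ordered_mon x e) = ordered_mon g e.
Proof.
have evac i j : ev A g (anticomm (x i) (x j)) = anticomm (g i) (g j).
  by rewrite /anticomm linearD /= !evM !ev_letter.
by case: e => [[[a b] c] [[d p] q]] /=; rewrite !evM !evX !evac !ev_letter.
Qed.

Lemma map_ordered_mon (g : nat -> 'M[{poly K}]_2) (u : K) e :
  map_mx (horner_eval u) (ordered_mon g e) = ordered_mon (fun i => map_mx (horner_eval u) (g i)) e.
Proof.
have mac i j : map_mx (horner_eval u) (anticomm (g i) (g j)) =
   anticomm (map_mx (horner_eval u) (g i)) (map_mx (horner_eval u) (g j)).
  by rewrite /anticomm rmorphD !rmorphM.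
by case: e => [[[a b] c] [[d p] q]] /=; rewrite !rmorphM !rmorphXn /= !mac.
Qed.

(** By induction on the number of terms: the terms of lowest order all carry the same
    exponents, so their coefficients add up to 0 and these terms can be removed. *)
Lemma vanishes_mon_sum (l : seq (K * exponents)) :
  vanishes (\sum_(p <- l) p.1 *: ordered_mon x p.2) -> \sum_(p <- l) p.1 *: ordered_mon x p.2 = 0.
Proof.
have [k] := ubnP (size l); elim: k l => // k IH [|p0 l0] sl vl; first by rewrite big_nil.
move: sl vl; set l := p0 :: l0 => sl vl.
pose n := (\sum_(p <- l) total p.2).+2.
have n1 : (1 < n)%N by [].
have ln p : p \in l -> (total p.2 < n)%N.
  by move=> pl; rewrite /n (big_rem p) //= -addnS -addnS -[X in (X < _)%N]addn0 ltn_add2l.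
pose g := witness K n.
have sum0 : \sum_(p <- l) (p.1)%:P *: ordered_mon g p.2 = 0.
  apply/matrixP => i j; rewrite [RHS]mxE; apply: (poly_eq0_char0 charK0) => u.
  pose gu k := map_mx (horner_eval u) (g k).
  have : ev A gu (\sum_(p <- l) p.1 *: ordered_mon x p.2) = 0.
    by apply: vl => q; rewrite /gu trace_map_mx trace_witness // rmorph0.
  rewrite linear_sum /= => /matrixP/(_ i j); rewrite !summxE [RHS]mxE => <-.
  rewrite horner_sum; apply: eq_bigr => p _.
  rewrite linearZ /= ev_ordered_mon -map_ordered_mon !mxE /horner_eval hornerM hornerC //.
have [p1 p1l p1min] : exists2 p1, p1 \in l &
    forall p, p \in l -> (order_of n p1.2 <= order_of n p.2)%N.
  by apply: (exists_argmin (fun p : K * exponents => order_of n p.2)).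
have := lead_sum0 (c := fun p : K * exponents => p.1) (k := fun p => order_of n p.2)
   (p := fun p => lead_of K p.2) (P := fun p => ordered_mon g p.2)
   (fun p _ => lead_ordered_mon K n1 p.2) p1min sum0.
have same p : p \in l -> (order_of n p.2 == order_of n p1.2) = (p.2 == p1.2).
  move=> pl; apply/eqP/eqP => [|-> //]; exact: (order_of_inj n1 (ln p pl) (ln p1 p1l)).
rewrite big_seq_cond (eq_bigl (fun p => (p \in l) && (p.2 == p1.2))); last first.
  by move=> p /=; case pl : (p \in l) => //=; exact: same.
rewrite -big_seq_cond (eq_bigr (fun p => p.1 *: lead_of K p1.2)); last by move=> p /eqP ->.
rewrite -scaler_suml => /eqP; rewrite scaler_eq0 => /orP[|/eqP z]; last first.
  by have := lead_of_unit charK0 p1.2; rewrite z unitr0.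
move=> /eqP c0.
have E : \sum_(p <- l | p.2 == p1.2) p.1 *: ordered_mon x p.2 = 0.
  rewrite (eq_bigr (fun p => p.1 *: ordered_mon x p1.2)); last by move=> p /eqP ->.
  by rewrite -scaler_suml c0 scale0r.
rewrite (bigID (fun p => p.2 == p1.2)) /= E add0r -big_filter.
rewrite (bigID (fun p => p.2 == p1.2)) /= E add0r -big_filter in vl.
apply: IH vl; rewrite size_filter; rewrite ltnS in sl; apply: leq_trans sl.
rewrite -(count_predC (fun p : K * exponents => p.2 == p1.2) l) -[X in (X <= _)%N]add1n.
by rewrite leq_add2r -has_count; apply/hasP; exists p1.
Qed.

End Independence.

(** * Transfer to the free associative algebra *)

Section LinearExtension.
Variables (K : fieldType) (G : choiceType) (V : lmodType K) (phi : G -> V).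
Implicit Types f g : {malg K[G]}.

Definition linext f : V := \sum_(w <- msupp f) f@_w *: phi w.

Lemma linextEw f (D : {fset G}) : (msupp f `<=` D)%fset ->
  linext f = \sum_(w <- D) f@_w *: phi w.
Proof.
move=> sub; rewrite /linext (big_fset_incl _ sub) // => w _.
by rewrite -mcoeff_eq0 => /eqP ->; rewrite scale0r.
Qed.

Lemma linext_is_linear : linear linext.
Proof.
move=> c f g; pose D := (msupp f `|` msupp g)%fset.
have sub : (msupp (c *: f + g) `<=` D)%fset.
  apply: fsubset_trans (msuppD_le _ _) _.
  by apply: fsetUSS (fsubset_refl _); exact: msuppZ_le.
rewrite (linextEw sub) (linextEw (fsubsetUl _ _ : msupp f `<=` D)%fset).
rewrite (linextEw (fsubsetUr _ _ : msupp g `<=` D)%fset) scaler_sumr -big_split /=.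
by apply: eq_bigr => w _; rewrite mcoeffD mcoeffZ scalerDl scalerA.
Qed.

HB.instance Definition _ :=
  GRing.isLinear.Build K {malg K[G]} V *:%R linext linext_is_linear.

Lemma linextU w : linext << w >> = phi w.
Proof.
have sub : (msupp (<< w >> : {malg K[G]}) `<=` [fset w])%fset by exact: msuppU_le.
by rewrite (linextEw sub) big_seq_fset1 mcoeffUU scale1r.
Qed.

End LinearExtension.

Section EvalGenerators.
Variables (K : fieldType) (A : free_algebra K) (R : algType K) (g : nat -> R).

Lemma ev_anticomm u v : ev A g (anticomm u v) = anticomm (ev A g u) (ev A g v).
Proof. by rewrite /anticomm linearD /= !evM. Qed.

Lemma ev_lie_bracket u v : ev A g (lie_bracket u v) = lie_bracket (ev A g u) (ev A g v).
Proof. by rewrite /lie_bracket linearB /= !evM. Qed.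

Lemma ev_comm_sq :
  ev A g (lie_bracket (letter A 0 ^+ 2) (letter A 1)) = lie_bracket (g 0 ^+ 2) (g 1).
Proof. by rewrite ev_lie_bracket evX !ev_letter. Qed.

Lemma ev_standard_poly4 :
  ev A g (\sum_(s : 'S_4) (-1) ^+ s *: \prod_(i < 4) letter A (s i)) =
  alt4 (g 0) (g 1) (g 2) (g 3).
Proof.
rewrite -alt_prod4 /alt_prod linear_sum; apply: eq_bigr => s _ /=.
rewrite linearZ /=.
have -> : ev A g (\prod_(i < 4) letter A (s i)) = \prod_(i < 4) g (s i).
  elim/big_rec2: _ => [|i u v _ <-]; first by rewrite ev1.
  by rewrite evM ev_letter.
by case: (odd_perm s); rewrite ?expr1 ?expr0 ?scale1r ?scaleN1r ?mul1r ?mulN1r.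
Qed.

End EvalGenerators.

Section Concrete.
Variable K : fieldType.

Lemma prod_var (w : {fmonom nat}) : \prod_(i <- w) var K i = << w >>.
Proof.
case: w => s; elim: s => [|i s IH] /=; first by rewrite big_nil -fmoneE.
rewrite big_cons IH /var.
have -> : FMonom (i :: s) = fmmul (fmu i) (FMonom s).
  by apply/eqP; rewrite fmP fmmulE fmuE.
by rewrite malgM_def fgmulUU mulr1.
Qed.

Lemma free_alg_scalerAr (c : K) (f g : free_alg K) : c *: (f * g) = f * (c *: g).
Proof.
rewrite scalerAl -[c *: g]mul_malgC mulrA; congr (_ * _).
rewrite -mul_malgC (monalgE f) mulr_sumr mulr_suml; apply: eq_bigr => w _.
by rewrite !malgM_def !fgmulUU mul1m mulm1 mulrC.
Qed.

Definition free_algType : algType K :=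
  HB.pack (free_alg K) (GRing.Lalgebra_isAlgebra.Build K (free_alg K) free_alg_scalerAr).

Lemma free_alg_lift (V : lmodType K) (phi : seq nat -> V) s :
  linext (fun w : {fmonom nat} => phi w) (\prod_(i <- s) var K i) = phi s.
Proof. by rewrite (prod_var (FMonom s)) linextU. Qed.

Lemma free_alg_span (P : free_alg K -> Prop) :
  P 0 -> (forall c f g, P f -> P g -> P (c *: f + g)) ->
  (forall s, P (\prod_(i <- s) var K i)) -> forall f, P f.
Proof.
move=> P0 PD Pw f; rewrite (monalgE f).
elim/big_rec: _ => // w g _ Pg.
have -> : << f@_w *g w >> = f@_w *: (<< w >> : free_alg K).
  apply/malgP => k; rewrite mcoeffZ [RHS]/= !mcoeffU.
  by case: (w == k); rewrite ?mulr1 ?mulr0.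
by apply: PD => //; rewrite -prod_var.
Qed.

Definition free_alg_free : free_algebra K :=
  @FreeAlgebra K free_algType (var K) (fun V phi => linext (fun w : {fmonom nat} => phi w))
    free_alg_lift free_alg_span.

Lemma evalE (R : algType K) (g : nat -> R) (f : free_alg K) : eval g f = ev free_alg_free g f.
Proof.
rewrite /eval /mmap; apply: eq_bigr => w _.
by rewrite /= mulr_algl.
Qed.

Local Notation FX := free_alg_free.

Lemma eval_comm_sq (R : algType K) (g : nat -> R) :
  eval g (comm_sq K) = lie_bracket (g 0%N ^+ 2) (g 1%N).
Proof. by rewrite evalE; exact: (ev_comm_sq FX). Qed.

Lemma eval_standard_poly4 (R : algType K) (g : nat -> R) :
  eval g (standard_poly K 4) = alt4 (g 0%N) (g 1%N) (g 2%N) (g 3%N).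
Proof. by rewrite evalE; exact: (ev_standard_poly4 FX). Qed.

(** Cayley-Hamilton: the square of a traceless 2x2 matrix is scalar. *)
Lemma sl2_sq_central (a b : 'M[K]_2) : \tr a = 0 -> lie_bracket (a ^+ 2) b = 0.
Proof.
rewrite /mxtrace !big_ord_recl big_ord0 addr0 => /eqP; rewrite addr_eq0 => /eqP tra.
have aa : a ^+ 2 = (a ord0 ord0 ^+ 2 + a ord0 (lift ord0 ord0) * a (lift ord0 ord0) ord0)%:M.
  apply/matrixP => i j; rewrite expr2 !mxE !big_ord_recl big_ord0 addr0 /=.
  have ord2 (k : 'I_2) : k = ord0 \/ k = lift ord0 ord0.
    by case: k => [[|[|//]] ?]; [left|right]; apply/val_inj.
  by case: (ord2 i) => ->; case: (ord2 j) => -> /=; rewrite ?tra /=; ring.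
by rewrite aa /lie_bracket -!mulmxE scalar_mxC subrr.
Qed.

Lemma sl2_acomm (a b c : 'M[K]_2) : \tr a = 0 -> \tr b = 0 -> acomm_lie a b c = 0.
Proof.
move=> a0 b0; rewrite acomm_lie_bracketD !sl2_sq_central ?subr0 //.
by rewrite linearD /= a0 b0 addr0.
Qed.

Lemma trace_lie_bracket (a b : 'M[K]_2) : \tr (lie_bracket a b) = 0.
Proof. by rewrite /lie_bracket linearB /= -!mulmxE mxtrace_mulC subrr. Qed.

Lemma gen_ideal_zero (R : pzRingType) (a : R) : gen_ideal (eq^~ 0) a -> a = 0.
Proof.
elim=> {a} [a||a b _ -> _ ->|r a _ ->|r a _ ->] //; first by rewrite addr0.
  by rewrite mulr0.
by rewrite mul0r.
Qed.

Lemma sl2_alt4 (a b c d : 'M[K]_2) :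
  \tr a = 0 -> \tr b = 0 -> \tr c = 0 -> \tr d = 0 -> alt4 a b c d = 0.
Proof.
move=> a0 b0 c0 d0; apply: gen_ideal_zero.
apply: (@alt4_gen_ideal _ _ (fun m : 'M[K]_2 => \tr m = 0)) => // [u v _ _|u v w u0 v0 _].
  exact: trace_lie_bracket.
by apply: gen_ideal_mem; exact: sl2_acomm.
Qed.

Lemma letter_ideal_vanishes (A : free_algebra K) (f : A) :
  gen_ideal (@letter_relation K A) f -> vanishes f.
Proof.
move=> If g g0; elim: If => {f} [_ [i j k|i j k l]||f h _ Hf _ Hh|r f _ Hf|r f _ Hf].
- by rewrite /acomm_lie ev_lie_bracket ev_anticomm !ev_letter [LHS]sl2_acomm.
- by rewrite /alt4 linearD linearB /= !ev_anticomm !ev_lie_bracket !ev_letter [LHS]sl2_alt4.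
- exact: linear0.
- by rewrite linearD /= Hf Hh addr0.
- by rewrite evM Hf mulr0.
- by rewrite evM Hf mul0r.
Qed.

Lemma vanishes_letter_ideal (A : free_algebra K) (charK0 : [pchar K] =i pred0) (f : A) :
  vanishes f -> gen_ideal (@letter_relation K A) f.
Proof.
apply: (vanishes_homog_ind charK0) => u g Hg vg.
apply: (reduction_to_three_letters charK0 (T := @vanishes K A)) Hg vg.
  by move=> a b h; exact: vanishes_polar.
move=> {}u {}g u3 Hg vg.
have [l Il] := mon_span_sum (mon_span_homog u3 Hg).
have vS : vanishes (\sum_(p <- l) p.1 *: ordered_mon (letter A) p.2).
  move=> m m0; have := letter_ideal_vanishes Il m0; rewrite linearB /= vg // sub0r => /eqP.
  by rewrite oppr_eq0 => /eqP.
by rewrite (vanishes_mon_sum charK0 vS) subr0 in Il.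
Qed.

Lemma spX_var i : spX K (var K i).
Proof. by exists [:: i], (fun=> 1); rewrite big_seq1 scale1r. Qed.

Lemma spX0 : spX K 0.
Proof. by exists [::], (fun=> 0); rewrite big_nil. Qed.

Lemma spX_add_var i j : spX K (var K i + var K j).
Proof.
by exists [:: i; j], (fun=> 1); rewrite big_cons big_seq1 !scale1r.
Qed.

Lemma lieX_spX f : spX K f -> lieX K f.
Proof.
case=> s [c ->]; elim/big_rec: _ => [|i g _ Hg].
  by rewrite -(scale0r (var K 0)); apply: lieX_scale; exact: lieX_var.
by apply: lieX_add => //; apply: lieX_scale; exact: lieX_var.
Qed.

Local Notation GL_gens := (fun h => h = comm_sq K \/ h = standard_poly K 4).

Lemma Omega_comm_sq (Omega H : free_alg K -> Prop) u v :
  Omega 0 -> H (comm_sq K) -> Omega u -> Omega v ->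
  Omega_ideal Omega H (lie_bracket (u ^+ 2) v).
Proof.
move=> O0 Hc Ou Ov; apply: gen_ideal_mem.
exists (comm_sq K), (nth 0 [:: u; v]); split=> //.
  by case=> [|[|i]] //=; rewrite nth_nil.
by rewrite (eval_comm_sq (R := free_algType)).
Qed.

Lemma Omega_standard_poly4 (Omega H : free_alg K -> Prop) p q r s :
  Omega 0 -> H (standard_poly K 4) -> Omega p -> Omega q -> Omega r -> Omega s ->
  Omega_ideal Omega H (alt4 p q r s).
Proof.
move=> O0 Hc Op Oq Or Os; apply: gen_ideal_mem.
exists (standard_poly K 4), (nth 0 [:: p; q; r; s]); split=> //.
  by case=> [|[|[|[|i]]]] //=; rewrite nth_nil.
by rewrite (eval_standard_poly4 (R := free_algType)).
Qed.

Lemma Omega_acomm_lie (Omega H : free_alg K -> Prop) u v w :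
  Omega 0 -> H (comm_sq K) -> Omega u -> Omega v -> Omega (u + v) -> Omega w ->
  Omega_ideal Omega H (acomm_lie u v w).
Proof.
move=> O0 Hc Ou Ov Ouv Ow; rewrite acomm_lie_bracketD.
by apply: gen_idealB; [apply: gen_idealB|]; exact: Omega_comm_sq.
Qed.

Lemma letter_ideal_GL (f : FX) : gen_ideal (@letter_relation K FX) f -> GL_ideal GL_gens f.
Proof.
apply: gen_ideal_sub => h [i j k|i j k l].
  apply: (@Omega_acomm_lie (spX K) GL_gens); try exact: spX_var.
  - exact: spX0.
  - by left.
  - exact: spX_add_var.
apply: (@Omega_standard_poly4 (spX K) GL_gens); try exact: spX_var.
- exact: spX0.
- by right.
Qed.

Lemma GL_ideal_lie f : GL_ideal GL_gens f -> Omega_consequence (lieX K) (comm_sq K) f.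
Proof.
have L0 : lieX K 0 by apply: lieX_spX; exact: spX0.
apply: gen_ideal_sub => _ [h [w [[->|->] Hw ->]]]; have {}Hw i := lieX_spX (Hw i).
  by apply: gen_ideal_mem; exists (comm_sq K), w.
rewrite (eval_standard_poly4 (R := free_algType)).
apply: (@alt4_gen_ideal _ _ (lieX K)) => //; first exact: lieX_bracket.
move=> u v t Hu Hv Ht; apply: Omega_acomm_lie => //.
exact: lieX_add.
Qed.

Lemma trace_eval_lieX (g : nat -> 'M[K]_2) f :
  (forall i, \tr (g i) = 0) -> lieX K f -> \tr (eval g f) = 0.
Proof.
move=> g0; rewrite evalE; elim=> {f} [i|a b _ Ha _ Hb|c a _ Ha|a b _ Ha _ Hb].
- by rewrite (ev_letter FX).
- by rewrite linearD linearD /= Ha Hb addr0.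
- by rewrite linearZ linearZ /= Ha mulr0.
- by rewrite (ev_lie_bracket (A := FX)) trace_lie_bracket.
Qed.

Lemma lie_consequence_vanishes (f : free_alg K) :
  Omega_consequence (lieX K) (comm_sq K) f -> @vanishes K FX f.
Proof.
move=> If g g0; elim: If => {f} [_ [h [w [-> Hw ->]]]||a b _ Ha _ Hb|r a _ Ha|r a _ Ha].
- rewrite (eval_comm_sq (R := free_algType)) (ev_lie_bracket (A := FX)) (evX (A := FX)).
  rewrite sl2_sq_central //.
  by rewrite -evalE trace_eval_lieX.
- exact: linear0.
- by rewrite linearD /= Ha Hb addr0.
- by rewrite (evM (A := FX)) Ha mulr0.
- by rewrite (evM (A := FX)) Ha mul0r.
Qed.

Lemma weak_identityE (f : free_alg K) : weak_identity (sl2 K) f <-> @vanishes K FX f.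
Proof.
split=> Hf g g0.
  by rewrite -evalE; apply: Hf => i; rewrite inE g0.
by rewrite evalE; apply: Hf => i; apply/eqP; have := g0 i; rewrite inE.
Qed.

End Concrete.

Theorem corollary2 (K : fieldType) (charK0 : [pchar K] =i pred0) :
  (forall f : free_alg K,
     weak_identity (sl2 K) f <->
     GL_ideal (fun h => h = comm_sq K \/ h = standard_poly K 4) f) /\
  (forall f : free_alg K,
     weak_identity (sl2 K) f -> Omega_consequence (lieX K) (comm_sq K) f).
Proof.
have weak_GL (f : free_alg K) : weak_identity (sl2 K) f ->
    GL_ideal (fun h => h = comm_sq K \/ h = standard_poly K 4) f.
  by move=> /weak_identityE /(vanishes_letter_ideal charK0); exact: letter_ideal_GL.
split=> f; last by move=> /weak_GL; exact: GL_ideal_lie.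
split=> [/weak_GL //|/GL_ideal_lie If].
by apply/weak_identityE; exact: lie_consequence_vanishes.
Qed.
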